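(* Let $p$ be an odd prime and $G$ a finite non-abelian $p$-group with cyclic center. If $C_G\big(Z(\gamma_3(G)G^p)\big)\not\le\gamma_3(G)G^p$, then $G$ has a non-inner automorphism of order $p$.
   Context: $\gamma_3(G)$ is the third term of the lower central series and $G^p=\langle g^p:g\in G\rangle$. *)

(* Defs.v *)
From mathcomp Require Import all_boot all_fingroup all_solvable.
Set Implicit Arguments. Unset Strict Implicit. Unset Printing Implicit Defensive.
Local Open Scope group_scope.

Definition pow_subgroup (gT : finGroupType) (G : {set gT}) (p : nat) : {set gT} :=
  <<[set x ^+ p | x in G]>>.

Definition Inn (gT : finGroupType) (G : {group gT}) : {set {perm gT}} :=
  [set conj_aut G x | x in G].

(* Main.v *)
Require Import Defs.
From mathcomp Require Import all_boot all_fingroup all_solvable all_algebra.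
From mathcomp Require Import ring.

(** Suppose that every automorphism of order [p] is inner. Write [Phi] for the
    Frattini subgroup, [N] for [gamma_3(G) G^p], [W] for [Omega_1(Z(Phi))] and
    [z] for a generator of [Omega_1(Z(G))]. As the center is cyclic, an additive
    [chi : W -> F_p] with [chi z = 1] embeds [W], as a [G]-module, in the functions
    [G -> F_p] by [x |-> (h |-> chi (x ^ h))]. A function [F] whose differences
    [F (g h) - F h] all lie in this image gives a derivation [G -> W], hence an
    automorphism [g |-> g d(g)] of order [1] or [p], which has to be the conjugation
    by some [u]: then [u] realizes [F]. The same holds over larger elementary
    abelian normal subgroups.

    Additive [F] show that [C_G(Phi) <= Phi]. As [G / N] has class at most [2] and
    exponent [p], every [x] in [Phi \ N] is detected by some [F] vanishing on [N]
    and satisfying [F (g h) = F g + F h + b g h] with [b] biadditive; such an [F] is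
    realized by an element [w] of [C_G(N)], with [[w, x]] a nontrivial power of [z].
    The hypothesis on [C_G(Z(N))] produces such a [w] of order [p] for which
    moreover [[x, C_G(N)] <= Z(G)]. Finally, for a suitable additive [eps] and a
    correction term [C] of degree at most [3], the function [eps F + C] is realized
    over [<w> C_W(w)] by some [u] in [C_G(N)] whose commutator with [x] corresponds
    to the nonconstant function [eps (F x)], so it is not central: a contradiction. *)

Set Implicit Arguments. Unset Strict Implicit. Unset Printing Implicit Defensive.
Import GRing.Theory.
Local Open Scope group_scope.

(** * Additive functions *)

Definition additive_on (gT : finGroupType) (p : nat) (A : {set gT})
    (f : gT -> 'F_p) :=
  {in A &, forall g h, f (g * h) = (f g + f h)%R}.

Section AdditiveFunctions.

Variables (gT : finGroupType) (p : nat).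
Hypothesis p_pr : prime p.
Implicit Types (A X : {group gT}) (f : gT -> 'F_p).

Lemma natFp_eq0 n : ((n%:R : 'F_p) == 0)%R = (p %| n).
Proof. by rewrite -(dvdn_pcharf (pchar_Fp p_pr)). Qed.

Lemma natFpK (c : 'F_p) : (((c : nat)%:R : 'F_p) = c)%R.
Proof. exact: natr_Zp. Qed.

Lemma additive1 A f : additive_on A f -> f 1 = 0%R.
Proof.
move=> fM; apply: (addrI (f 1)).
by rewrite -fM ?group1 // mulg1 addr0.
Qed.

Lemma additiveV A f : additive_on A f -> {in A, forall x, f x^-1 = (- f x)%R}.
Proof.
move=> fM x Ax; apply: (addrI (f x)).
by rewrite -fM ?groupV // mulgV (additive1 fM) subrr.
Qed.

Lemma additiveX A f n :
  additive_on A f -> {in A, forall x, f (x ^+ n) = (n%:R * f x)%R}.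
Proof.
move=> fM x Ax; elim: n => [|n IHn]; first by rewrite (additive1 fM) mul0r.
by rewrite expgS fM ?groupX // IHn -[n.+1]add1n natrD mulrDl mul1r.
Qed.

Lemma additiveJ A f : additive_on A f -> {in A &, forall x y, f (x ^ y) = f x}.
Proof.
move=> fM x y Ax Ay.
by rewrite conjgE !fM ?groupM ?groupV // (additiveV fM) // addrC addrK.
Qed.

Lemma additiveR A f : additive_on A f -> {in A &, forall x y, f [~ x, y] = 0%R}.
Proof.
move=> fM x y Ax Ay; rewrite commgEl fM ?groupV ?groupJ //.
by rewrite (additiveV fM) // (additiveJ fM) // addNr.
Qed.

(** [f] is composed with the projection to [A] along a complement, which exists because [X] is
    elementary abelian. *)
Lemma extend_additive A X f :
    p.-abelem X -> A \subset X -> additive_on A f ->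
  exists2 f' : gT -> 'F_p, additive_on X f' & {in A, f' =1 f}.
Proof.
move=> abelX sAX fM; have [H complH] := splitsP (abelem_splits abelX sAX).
have [tiAH defX] := complP complH.
have sHX : H \subset X by rewrite -defX mulG_subr.
have cAH : H \subset 'C(A) := sub_abelian_cent2 (abelem_abelian abelX) sHX sAX.
exists (f \o divgr A H) => [x y Xx Xy | x Ax] /=.
  rewrite (divgrM complH) // fM // mem_divgr ?defX //.
by rewrite -{1}[x]mulg1 (divgrMid tiAH) // group1.
Qed.

Lemma additive_cycle (x : gT) :
  #[x] = p -> exists2 f : gT -> 'F_p, additive_on <[x]> f & f x = 1%R.
Proof.
move=> ox.
have ex_c (y : gT) : exists c : 'F_p, forall i, y = x ^+ i -> c = i%:R%R.
  have [/cycleP[i ->] | x'y] := boolP (y \in <[x]>); last first.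
    by exists 0%R => i yi; case/negP: x'y; rewrite yi mem_cycle.
  exists i%:R%R => j /eqP; rewrite eq_expg_mod_order ox => /eqP eq_ij.
  by rewrite -(Fp_nat_mod p_pr i) eq_ij Fp_nat_mod.
have [f fE] := fin_all_exists ex_c; exists f; last exact: (fE x 1%N).
move=> _ _ /cycleP[i ->] /cycleP[j ->].
have fX i1 : f (x ^+ i1) = i1%:R%R := fE _ i1 erefl.
by rewrite -expgD !fX natrD.
Qed.

Lemma separate_abelem X x :
  p.-abelem X -> x \in X -> x != 1 -> exists2 f : gT -> 'F_p, additive_on X f & f x = 1%R.
Proof.
move=> abelX Xx ntx; have ox := abelem_order_p abelX Xx ntx.
have [f0 f0M f0x] := additive_cycle ox.
have sxX : <[x]> \subset X by rewrite cycle_subG.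
have [f fM eq_f] := extend_additive abelX sxX f0M.
by exists f; rewrite // eq_f ?cycle_id.
Qed.

End AdditiveFunctions.

Section Separation.

Variables (gT : finGroupType) (p : nat).
Hypothesis p_pr : prime p.
Implicit Types X : {group gT}.

Lemma separate_Phi X x :
    p.-group X -> x \in X -> x \notin 'Phi(X) ->
  exists2 f : gT -> 'F_p, additive_on X f & f x <> 0%R.
Proof.
move=> pX Xx Phi'x; have nPhiX : X \subset 'N('Phi(X)) := normal_norm (Phi_normal X).
have Px : coset 'Phi(X) x \in X / 'Phi(X) by rewrite mem_quotient.
have ntx : coset 'Phi(X) x != 1.
  apply: contra Phi'x => /eqP/coset_idr-> //; exact: subsetP Xx.
have [f fM fx] := separate_abelem p_pr (Phi_quotient_abelem pX) Px ntx.
exists (f \o coset 'Phi(X)) => [y z Xy Xz | ] /=; last by rewrite fx; exact/eqP/GRing.oner_neq0.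
by rewrite morphM ?(subsetP nPhiX) // fM ?mem_quotient.
Qed.

(** The kernel contains all commutators and [p]-th powers, which generate the Frattini subgroup of a
    [p]-group. *)
Lemma additive_Phi X (f : gT -> 'F_p) :
  p.-group X -> additive_on X f -> {in 'Phi(X), forall x, f x = 0%R}.
Proof.
move=> pX fM; pose K := [set x in X | f x == 0%R].
have gK : group_set K.
  apply/group_setP; split=> [|x y]; first by rewrite inE group1 (additive1 fM) eqxx.
  rewrite !inE => /andP[Xx /eqP fx] /andP[Xy /eqP fy].
  by rewrite groupM // fM // fx fy addr0 eqxx.
suff sPhiK: 'Phi(X) \subset K by move=> x /(subsetP sPhiK); rewrite inE => /andP[_ /eqP].
rewrite (Phi_joing pX) -[K]/(gval (Group gK)) join_subG; apply/andP; split.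
  rewrite gen_subG; apply/subsetP=> _ /imset2P[x y Xx Xy ->].
  by rewrite inE groupR //= (additiveR fM).
rewrite (MhoE 1 pX) gen_subG; apply/subsetP=> _ /imsetP[x Xx ->].
have p0 : (p%:R = 0 :> 'F_p)%R by apply/eqP; rewrite natFp_eq0.
by rewrite inE groupX //= (additiveX _ fM) // expn1 p0 mul0r.
Qed.
End Separation.

(** * Derivations *)

Section Derivations.

Variables (gT : finGroupType) (G X : {group gT}) (p : nat).
Variables (chi F : gT -> 'F_p).
Hypotheses (p_pr : prime p) (p_odd : odd p).
Hypothesis autG_inner :
  forall a : {perm gT}, a \in Aut G -> #[a] = p -> a \in Inn G.
Hypotheses (nXG : X <| G) (abelX : p.-abelem X) (chiM : additive_on X chi).
Hypothesis chi_faithful :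
  {in X, forall x, {in G, forall h, chi (x ^ h) = 0%R} -> x = 1}.

Lemma chi_inj : {in X &, forall x y,
  {in G, forall h, chi (x ^ h) = chi (y ^ h)} -> x = y}.
Proof.
move=> x y Xx Xy eq_xy; apply/eqP; rewrite eq_mulgV1; apply/eqP.
have XJ u h : u \in X -> h \in G -> u ^ h \in X.
  by move=> Xu Gh; rewrite memJ_norm // (subsetP (normal_norm nXG)).
apply: chi_faithful => [|h Gh]; first by rewrite groupM ?groupV.
rewrite conjMg conjVg chiM ?groupV ?XJ // (additiveV chiM) ?XJ //.
by rewrite eq_xy // subrr.
Qed.

(* The derivation [d] with [chi (d g ^ h) = F h - F (g h)] satisfies [d (d (d g)) = 1], so
   the [n]-th iterate of [g |-> g d(g)] is [g d(g)^n d(d(g))^C(n, 2)], which is [g] for [n = p]. *)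
Lemma realize_inner :
    {in G, forall g, exists2 x, x \in X
      & {in G, forall h, chi (x ^ h) = (F (g * h) - F h)%R}} ->
    {in X & G, forall x h, (F (x * h) - F h)%R = (F x - F 1)%R} ->
    {in X, forall x, {in G, forall h, chi (x ^ h) = chi x} ->
       {in G, forall h, F (x * h) = F h}} ->
  exists2 u, u \in G & {in G, forall g, [~ u, g] \in X
    /\ {in G, forall h, chi ([~ u, g] ^ h) = (F (g * h) - F h)%R}}.
Proof.
move=> repF FX FZ.
have sXG := normal_sub nXG; have nXG' := subsetP (normal_norm nXG).
have XJ u h : u \in X -> h \in G -> u ^ h \in X by move=> Xu Gh; rewrite memJ_norm ?nXG'.
have [abX Xp] := abelemP p_pr abelX.
(* The sign makes [d g] equal to [[~ g, u]], the inverse of [[~ u, g]], once the automorphism is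
   conjugation by [u]. *)
have ex_d g : exists x, g \in G ->
    x \in X /\ {in G, forall h, chi (x ^ h) = (F h - F (g * h))%R}.
  have [Gg | _] := boolP (g \in G); last by exists 1.
  have [x Xx xE] := repF g Gg; exists x^-1 => _; rewrite groupV; split=> // h Gh.
  by rewrite conjVg (additiveV chiM) ?XJ // xE // opprB.
have [d dP] := fin_all_exists ex_d.
have dX g : g \in G -> d g \in X by case/dP.
have dG g : g \in G -> d g \in G by move/dX/(subsetP sXG).
have dE g h : g \in G -> h \in G -> chi (d g ^ h) = (F h - F (g * h))%R.
  by move=> Gg; case: (dP g Gg) => _; apply.
have dM : {in G &, forall g h, d (g * h) = d g ^ h * d h}.
  move=> g h Gg Gh; have Ggh := groupM Gg Gh.
  have Xgh : d g ^ h * d h \in X by rewrite groupM ?XJ ?dX.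
  apply: (chi_inj (dX _ Ggh) Xgh) => k Gk.
  have Ghk := groupM Gh Gk.
  rewrite conjMg -conjgM (chiM (XJ _ _ (dX _ Gg) Ghk) (XJ _ _ (dX _ Gh) Gk)).
  by rewrite !dE // mulgA; ring.
(* By [FX] the function of [d x] is constant, so [FZ] makes [F] invariant under [d x], and [d (d x)]
   has the zero function. *)
have ddd x : x \in X -> d (d x) = 1.
  move=> Xx; have Gx := subsetP sXG x Xx.
  have dxc k : k \in G -> chi (d x ^ k) = (F 1 - F x)%R.
    by move=> Gk; rewrite dE // -opprB FX // opprB.
  have dxF := FZ _ (dX x Gx).
  apply: chi_faithful => [|k Gk]; first by rewrite dX ?dG.
  rewrite dE ?dG // dxF ?subrr // => h Gh.
  by rewrite dxc // -[in RHS](conjg1 (d x)) dxc.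
pose phi g := g * d g.
have phiG g : g \in G -> phi g \in G by move=> Gg; rewrite groupM ?dG.
have phiM : {in G &, {morph phi : g h / g * h}}.
  by move=> g h Gg Gh; rewrite /phi dM // conjgE -!mulgA mulKVg.
have iterG n g : g \in G -> iter n phi g \in G by move=> Gg; elim: n => //= n; apply: phiG.
have phi_iter n : {in G, forall g, iter n phi g = g * d g ^+ n * d (d g) ^+ 'C(n, 2)}.
  move=> g Gg; elim: n => [|n IHn]; first by rewrite !mulg1.
  have phiX y m : y \in G -> phi (y ^+ m) = phi y ^+ m.
    move=> Gy; elim: m => [|m IHm]; last by rewrite !expgS phiM ?groupX // IHm.
    by rewrite !expg0 /phi mul1g; apply: (mulgI (d 1)); rewrite -{1}(conjg1 (d 1)) -dM // !mulg1.
  have cdd : commute (d g) (d (d g)).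
    by apply: (centsP abX); rewrite ?dX ?dG.
  have phidd : phi (d (d g)) = d (d g) by rewrite /phi (ddd (d g)) ?dX // mulg1.
  rewrite iterS IHn !phiM ?groupM ?groupX ?dG // !phiX ?dG // phidd.
  by rewrite /phi expgMn // binS bin1 addnC expgD expgS !mulgA.
have phip : {in G, forall g, iter p phi g = g}.
  move=> g Gg; rewrite phi_iter // Xp ?dX // mulg1.
  have /dvdnP[k ->] : p %| 'C(p, 2) by rewrite prime_dvd_bin ?odd_prime_gt2 //.
  by rewrite mulnC expgM Xp ?dX ?dG // expg1n mulg1.
pose f := Morphism phiM.
have injf : 'injm f.
  apply/injmP=> g h Gg Gh /= eq_gh.
  rewrite -(phip g Gg) -(phip h Gh) -(prednK (prime_gt0 p_pr)) !iterSr.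
  by congr (iter _ _ _).
have Gf : f @* G = G.
  apply/eqP; rewrite eqEcard card_injm // leqnn andbT.
  by apply/subsetP=> _ /morphimP[g _ Gg ->]; apply: phiG.
pose a := aut injf Gf.
have aE g : g \in G -> a g = phi g by move=> Gg; rewrite /a autE.
have Aa : a \in Aut G by apply: Aut_aut.
have ap : a ^+ p = 1.
  apply/permP=> g; rewrite perm1 permX.
  have [Gg | G'g] := boolP (g \in G).
    rewrite -[RHS](phip g Gg); elim: p => //= n ->; rewrite aE ?iterG //.
  by apply: iter_fix; apply: (out_Aut Aa).
have InnA : a \in Inn G.
  have [a1 | nta] := eqVneq a 1.
    by apply/imsetP; exists 1; rewrite // a1 morph1.
  by apply: autG_inner => //; apply: nt_prime_order.
have [u Gu def_a] := imsetP InnA; exists u => // g Gg.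
have def_d : [~ u, g] = (d g)^-1.
  have: g ^ u = phi g by rewrite -aE // def_a norm_conj_autE // (subsetP (normG G)).
  rewrite /phi => gu; apply: invg_inj; rewrite invgK invg_comm commgEl gu mulKg //.
split; first by rewrite def_d groupV dX.
move=> h Gh; rewrite def_d conjVg (additiveV chiM) ?XJ ?dX //.
by rewrite dE // opprB.
Qed.

End Derivations.

(** * Groups of class two *)

Definition biadditive_on (gT : finGroupType) (p : nat) (A : {set gT})
    (b : gT -> gT -> 'F_p) :=
  {in A, forall g, additive_on A (b g)} /\ {in A, forall h, additive_on A (b^~ h)}.

Section Class2Coordinate.

Variables (gT : finGroupType) (G K N : {group gT}) (p : nat).
Hypotheses (p_pr : prime p) (p_odd : odd p).
Hypotheses (nNG : N <| G) (sNK : N \subset K) (sKG : K \subset G).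
Hypotheses (sGGK : [~: G, G] \subset K) (sKGN : [~: K, G] \subset N).
Hypothesis powN : {in G, forall g, g ^+ p \in N}.

(* A linear coordinate for the Baer addition [g h [g, h]^(-1/2)] of [G / N]: modulo the
   diagonal of [K], the pairs [(g, g^-1)] generate an elementary abelian group in which
   the product of the pairs of [g] and [h] differs from that of [g h] by a commutator. *)
Lemma class2_coordinate x : x \in K -> x \notin N ->
  exists Lam : gT -> 'F_p, exists a, [/\ biadditive_on G a,
    {in G &, forall g h, Lam (g * h) = (Lam g + Lam h + a g h)%R},
    {in G &, forall g h, a g h = (- a h g)%R},
    {in N, forall n, Lam n = 0%R} & Lam x <> 0%R].
Proof.
move=> Kx N'x.
have NJ n g : n \in N -> g \in G -> n ^ g \in N.
  by move=> Nn Gg; rewrite memJ_norm // (subsetP (normal_norm nNG)).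
have GRK g h : g \in G -> h \in G -> [~ g, h] \in K.
  by move=> Gg Gh; rewrite (subsetP sGGK) ?mem_commg.
have KRN k g : k \in K -> g \in G -> [~ k, g] \in N.
  by move=> Kk Gg; rewrite (subsetP sKGN) ?mem_commg.
have KG := subsetP sKG; have NK := subsetP sNK.
pose GG := setX_group G G.
pose Dset := [set u : gT * gT | [&& u.1 \in K, u.2 \in K & u.1^-1 * u.2 \in N]].
have gD : group_set Dset.
  apply/group_setP; split=> [|[u1 u2] [v1 v2]]; first by rewrite inE /= invg1 mulg1 !group1.
  rewrite !inE /= => /and3P[Ku1 Ku2 Nu] /and3P[Kv1 Kv2 Nv].
  rewrite (groupM Ku1 Kv1) (groupM Ku2 Kv2) /= invMg.
  have -> : v1^-1 * u1^-1 * (u2 * v2) = (v1^-1 * v2) * (u1^-1 * u2) ^ v2.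
    by rewrite conjgE !mulgA mulgK.
  by rewrite groupM ?NJ ?KG.
pose D := Group gD.
have nDGG : GG \subset 'N(D).
  apply/normsP=> -[g h]; rewrite inE /= => /andP[Gg Gh].
  apply/eqP; rewrite eqEcard cardJg leqnn andbT; apply/subsetP=> _ /imsetP[[u1 u2] + ->].
  rewrite !inE /= => /and3P[Ku1 Ku2 Nu].
  have KJ k y : k \in K -> y \in G -> k ^ y \in K.
    by move=> Kk Gy; rewrite conjg_mulR groupM // NK ?KRN.
  rewrite !KJ //=.
  have -> : (u1 ^ g)^-1 * u2 ^ h = [~ u1, g]^-1 * (u1^-1 * u2) * [~ u2, h].
    rewrite !commgEl; move: (u1 ^ g) (u2 ^ h) => v1 v2.
    by rewrite invMg invgK !mulgA !mulgK.
  by apply: groupM (groupM _ Nu) (KRN _ _ Ku2 Gh); rewrite groupV KRN.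
pose e g : coset_of D := coset D (g, g^-1).
pose T := [set (g, g^-1) | g in G].
have sTGG : T \subset GG.
  by apply/subsetP=> _ /imsetP[g Gg ->]; rewrite inE /= groupV Gg.
have nDT := subset_trans sTGG nDGG.
pose Q := (<<T>> / D)%G.
have nDg g h : g \in G -> h \in G -> (g, h) \in 'N(D).
  by move=> Gg Gh; rewrite (subsetP nDGG) // inE /= Gg.
have Qe g : g \in G -> e g \in Q.
  by move=> Gg; rewrite mem_quotient // mem_gen // imset_f.
have defQ : Q = <<T / D>> :> {set _} by apply: (morphim_gen (coset_morphism D) nDT).
(* The coordinates of the commutator of two generators are [G]-conjugate elements of [K], hence
   congruent modulo [N]. *)
have abQ : abelian Q.
  rewrite defQ abelian_gen; apply/centsP=> u /morphimP[_ _ /imsetP[g Gg ->] ->{u}].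
  move=> v /morphimP[_ _ /imsetP[h Gh ->] ->{v}].
  apply/commgP; rewrite -morphR ?nDg ?groupV //=.
  suff Dgh : ([~ g, h], [~ g^-1, h^-1]) \in D by apply/eqP/(coset_id Dgh).
  rewrite inE /= !GRK ?groupV //=.
  have -> : [~ g^-1, h^-1] = [~ g, h] ^ (h * g)^-1.
    by rewrite /commg !conjgE !invgK !invMg !mulgA mulgK mulgV mul1g.
  by rewrite -commgEl KRN ?GRK ?groupV ?groupM.
have abelQ : p.-abelem Q.
  apply/(abelemP p_pr); split=> //.
  pose B := [set u in Q | u ^+ p == 1].
  have gB : group_set B.
    apply/group_setP; split=> [|u v]; first by rewrite inE group1 expg1n eqxx.
    rewrite !inE => /andP[Qu /eqP up] /andP[Qv /eqP vp].
    by rewrite groupM // expgMn ?up ?vp ?mulg1 ?eqxx //; apply: (centsP abQ).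
  suff sQB : Q \subset Group gB by move=> u /(subsetP sQB); rewrite inE => /andP[_ /eqP].
  rewrite defQ gen_subG; apply/subsetP=> u /morphimP[_ _ /imsetP[g Gg ->] ->{u}].
  rewrite inE [X in X && _]Qe // -morphX ?nDg ?groupV //; apply/eqP/coset_id.
  have expE (y z : gT) n : ((y, z) ^+ n : gT * gT) = (y ^+ n, z ^+ n).
    by elim: n => // n IHn; rewrite !expgS IHn.
  by rewrite expE inE /= !NK ?groupM ?groupV ?powN ?groupV.
have Gx := KG x Kx.
(* If [e x] were trivial, [x ^+ 2] would be in [N]; so is [x ^+ p] with [p] odd, hence [x] would be
   too. *)
have ntex : e x != 1.
  apply: contra N'x => /eqP/coset_idr; rewrite nDg ?groupV // => /(_ isT).
  rewrite inE /= => /and3P[_ _ Nx2].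
  have {}Nx2 : x ^+ 2 \in N by rewrite -groupV expgS expg1 invMg.
  have xp : x ^+ p = x * x ^+ 2 ^+ p./2.
    by rewrite -expgM -expgS mul2n -[p in LHS]odd_double_half p_odd.
  by rewrite -(groupMr x (groupX p./2 Nx2)) -xp powN.
have [chi chiM chix] := separate_abelem p_pr abelQ (Qe x Gx) ntex.
(* As [(g * h)^-1 = g^-1 * h^-1 * [~ h^-1, g^-1]], the class [s] of this commutator measures how far
   [e] is from multiplicative. *)
pose s c := coset D (1, c).
pose a g h := chi (s [~ h^-1, g^-1]).
have sM c c' : c \in K -> c' \in K -> s (c * c') = s c * s c'.
  by move=> Kc Kc'; rewrite /s -morphM ?nDg ?KG //=; congr (coset D (_, _)); rewrite mulg1.
have s1 n : n \in N -> s n = 1.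
  by move=> Nn; apply: coset_id; rewrite inE /= group1 NK // invg1 mul1g.
have eM g h : g \in G -> h \in G -> e (g * h) = e g * e h * s [~ h^-1, g^-1].
  move=> Gg Gh; have Gg' := groupVr Gg; have Gh' := groupVr Gh.
  have Gc : [~ h^-1, g^-1] \in G by rewrite groupR.
  rewrite /e /s -!morphM ?groupM ?nDg //=; congr (coset D (_, _)); first by rewrite /= mulg1.
  by rewrite /= -commgC invMg.
have Qs g h : g \in G -> h \in G -> s [~ h^-1, g^-1] \in Q.
  move=> Gg Gh; rewrite -(groupMl _ (groupM (Qe g Gg) (Qe h Gh))) -eM //.
  by rewrite Qe ?groupM.
have aN : {in G &, forall g h, a g h = (- a h g)%R}.
  move=> g h Gg Gh; rewrite /a -(additiveV chiM) ?Qs //; congr (chi _).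
  apply: (mulIg (s [~ g^-1, h^-1])); rewrite mulVg -sM ?GRK ?groupV //.
  by rewrite -(invg_comm g^-1) mulVg s1.
have aMl : {in G, forall h, additive_on G (a^~ h)}.
  move=> h Gh g g' Gg Gg'; rewrite /= /a -chiM ?Qs //; congr (chi _).
  rewrite invMg commgMJ conjg_mulR.
  have [Kc Kc'] := (GRK _ _ (groupVr Gh) (groupVr Gg), GRK _ _ (groupVr Gh) (groupVr Gg')).
  have Nn := KRN _ _ Kc' (groupVr Gg).
  by rewrite (sM _ _ Kc (groupM Kc' (NK _ Nn))) (sM _ _ Kc' (NK _ Nn)) (s1 _ Nn) mulg1.
exists (fun g => chi (e g)), a; split=> //.
- split=> // g Gg h h' Gh Gh'.
  by rewrite !(aN g) ?groupM // (aMl g) // opprD.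
- by move=> g h Gg Gh; rewrite eM // !chiM ?groupM ?Qe ?Qs.
- move=> n Nn; rewrite [e n]coset_id ?(additive1 chiM) //.
  by rewrite inE /= groupV !NK //= groupM ?groupV.
by rewrite chix; apply/eqP/oner_neq0.
Qed.

End Class2Coordinate.

(** * Cyclic center *)

Section CyclicCenter.

Variables (gT : finGroupType) (G : {group gT}) (p : nat) (z : gT).
Hypotheses (p_pr : prime p) (p_odd : odd p) (pG : p.-group G).
Hypotheses (cycZ : cyclic 'Z(G)) (Zz : z \in 'Z(G)) (oz : #[z] = p).

Lemma Ohm1Z : 'Ohm_1('Z(G)) = <[z]>.
Proof.
have ntz : z != 1 by rewrite -order_gt1 oz prime_gt1.
have pZ : p.-group 'Z(G) := pgroupS (center_sub G) pG.
apply/esym/eqP; rewrite eqEcard cycle_subG; apply/andP; split.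
  by have /= -> := OhmE 1 pZ; rewrite mem_gen // !inE -in_setI Zz expn1 -oz expg_order eqxx.
rewrite (Ohm1_cyclic_pgroup_prime cycZ pZ) -?oz //.
by apply: contraNneq ntz => Z1; move: Zz; rewrite Z1 inE.
Qed.

Lemma central_expp c : c \in 'Z(G) -> c ^+ p = 1 -> c \in <[z]>.
Proof.
move=> Zc cp; have pZ : p.-group 'Z(G) := pgroupS (center_sub G) pG.
by rewrite -Ohm1Z; have /= -> := OhmE 1 pZ; rewrite mem_gen // !inE -in_setI Zc expn1 cp eqxx.
Qed.

(** A nontrivial normal subgroup meets the center, whose only subgroup of order [p] is [<[z]>]. *)
Lemma central_socle_normal (K : {group gT}) : K <| G -> K :!=: 1 -> z \in K.
Proof.
move=> nKG ntK; have := meet_center_nil (pgroup_nil pG) nKG ntK.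
rewrite -[_ :&: _]/(gval (K :&: 'Z(G))%G) -Ohm1_eq1 => nt1.
have := OhmS 1 (subsetIr K 'Z(G)); rewrite Ohm1Z => sOz.
have prz : prime #|<[z]>| by rewrite -[#|_|]/#[z] oz.
have [szO | tiO] := prime_subgroupVti 'Ohm_1(K :&: 'Z(G)) prz.
  have := subset_trans szO (Ohm_sub 1 _); rewrite cycle_subG.
  by rewrite inE => /andP[].
by case/eqP: nt1; rewrite -(setIidPl sOz) tiO.
Qed.

(** The elements with zero function form a normal subgroup, which would contain [z] if it were
    nontrivial. *)
Lemma additive_faithful (X : {group gT}) (chi : gT -> 'F_p) :
    X <| G -> additive_on X chi -> (chi z != 0)%R ->
  {in X, forall x, {in G, forall h, chi (x ^ h) = 0%R} -> x = 1}.
Proof.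
move=> nXG chiM chiz x Xx chix0.
have XJ u h : u \in X -> h \in G -> u ^ h \in X.
  by move=> Xu Gh; rewrite memJ_norm // (subsetP (normal_norm nXG)).
pose K := [set y in X | [forall h in G, chi (y ^ h) == 0%R]].
have gK : group_set K.
  apply/group_setP; split=> [|u v].
    rewrite inE group1; apply/forall_inP=> h Gh.
    by rewrite conj1g (additive1 chiM).
  rewrite !inE => /andP[Xu /forall_inP u0] /andP[Xv /forall_inP v0].
  rewrite groupM //; apply/forall_inP=> h Gh.
  by rewrite conjMg chiM ?XJ // (eqP (u0 h Gh)) (eqP (v0 h Gh)) addr0.
have nKG : Group gK <| G.
  apply/andP; split.
    by apply/subsetP=> u; rewrite inE => /andP[/(subsetP (normal_sub nXG))].
  apply/normsP=> g Gg; apply/eqP; rewrite eqEcard cardJg leqnn andbT.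
  apply/subsetP=> _ /imsetP[u + ->]; rewrite !inE => /andP[Xu /forall_inP u0].
  rewrite XJ //; apply/forall_inP=> h Gh; rewrite -conjgM.
  by apply: u0; rewrite groupM.
have Kx : x \in Group gK by rewrite inE Xx; apply/forall_inP=> h /chix0->.
apply/eqP; apply: contraNT chiz => ntx.
have: z \in Group gK.
  by apply: central_socle_normal => //; apply/trivgPn; exists x.
rewrite inE => /andP[_ /forall_inP/(_ 1 (group1 G))].
by rewrite conjg1.
Qed.

(** An element of the cyclic [p]-group ['Z(G)] that is not a [p]-th power there generates it, so
    [u^-1] is a power of [v ^+ p]. *)
Lemma complete_power u v :
    u \in 'Z(G) -> v ^+ p \in 'Z(G) -> {in 'Z(G), forall c, v ^+ p <> c ^+ p} ->
  exists j, u * v ^+ (j * p) = 1.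
Proof.
have pZ : p.-group 'Z(G) := pgroupS (center_sub G) pG.
have [c defZ] := cyclicP cycZ; rewrite defZ => Zu /cycleP[i vp] badv.
have oc : p.-nat #[c] by rewrite /order -defZ.
have genv : generator <[c]> (c ^+ i).
  rewrite generator_coprime (pnat_coprime oc) // p'natE //.
  apply/negP=> /dvdnP[k def_i]; case: (badv (c ^+ k)); first exact: mem_cycle.
  by rewrite vp def_i expgM.
have: u^-1 \in <[c ^+ i]> by rewrite -(eqP genv) groupV.
case/cycleP=> j uj; exists j.
by rewrite mulnC expgM vp -uj mulgV.
Qed.

Lemma expp_mul (u v : gT) :
    commute u [~ v, u] -> commute v [~ v, u] -> [~ v, u] ^+ p = 1 ->
  (u * v) ^+ p = u ^+ p * v ^+ p.
Proof.
move=> cu cv vup; rewrite expMg_Rmul //.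
have /dvdnP[k ->] : p %| 'C(p, 2) by rewrite prime_dvd_bin ?odd_prime_gt2.
by rewrite mulnC expgM vup expg1n mulg1.
Qed.

End CyclicCenter.

(** * Functions on [G] that come from a normal subgroup *)

Definition represented (gT : finGroupType) (p : nat) (G X : {set gT})
    (chi F : gT -> 'F_p) :=
  exists2 x, x \in X & {in G, forall h, chi (x ^ h) = F h}.

Section Represented.

Variables (gT : finGroupType) (p : nat) (G X : {group gT}) (chi : gT -> 'F_p).
Hypotheses (p_pr : prime p) (nXG : X <| G) (chiM : additive_on X chi).
Implicit Types F : gT -> 'F_p.

Let XJ u h : u \in X -> h \in G -> u ^ h \in X.
Proof. by move=> Xu Gh; rewrite memJ_norm // (subsetP (normal_norm nXG)). Qed.

Lemma represented_ext F1 F2 :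
  {in G, F1 =1 F2} -> represented G X chi F1 -> represented G X chi F2.
Proof.
by move=> eqF [x Xx xF]; exists x => // h Gh; rewrite xF ?eqF.
Qed.

Lemma represented_add F1 F2 : represented G X chi F1 -> represented G X chi F2 ->
  represented G X chi (fun h => F1 h + F2 h)%R.
Proof.
move=> [x Xx xF] [y Xy yF]; exists (x * y) => [|h Gh]; first exact: groupM.
by rewrite conjMg chiM ?XJ // xF ?yF.
Qed.

Lemma represented_scale c F : represented G X chi F ->
  represented G X chi (fun h => c * F h)%R.
Proof.
move=> [x Xx xF]; exists (x ^+ (c : nat)) => [|h Gh]; first exact: groupX.
by rewrite conjXg (additiveX _ chiM) ?XJ // xF // natFpK.
Qed.

Lemma represented_sub F1 F2 : represented G X chi F1 -> represented G X chi F2 ->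
  represented G X chi (fun h => F1 h - F2 h)%R.
Proof.
move=> rF1 /(represented_scale (-1)%R) rF2.
apply: represented_ext (represented_add rF1 rF2) => h _ /=; ring.
Qed.

Lemma represented_central y :
    y \in X -> y \in 'Z(G) -> chi y = 1%R -> forall c,
  represented G X chi (fun=> c).
Proof.
move=> Xy Zy y1 c; have /centerP[_ cy] := Zy.
exists (y ^+ (c : nat)) => [|h Gh]; first exact: groupX.
rewrite conjXg conjgE (cy h Gh) mulKg.
by rewrite (additiveX _ chiM) // y1 mulr1 natFpK.
Qed.

End Represented.

(** Finiteness replaces excluded middle for a predicate in [Prop] that is decided pointwise. *)
Lemma fin_search (T : finType) (P : T -> Prop) :
  (forall t, P t \/ ~ P t) -> (exists t, P t) \/ (forall t, ~ P t).
Proof.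
move=> decP; have ex_b t : exists b : bool, b <-> P t.
  by case: (decP t) => ?; [exists true | exists false].
have [b bP] := fin_all_exists ex_b.
have [/existsP[t bt] | nb] := boolP [exists t, b t]; first by left; exists t; apply/bP.
by right=> t /bP bt; case/existsP: nb; exists t.
Qed.

(** * The module [W] and the elements realizing a function *)

Section Core.

Variables (gT : finGroupType) (G : {group gT}) (p : nat) (z : gT).
Hypotheses (p_pr : prime p) (p_odd : odd p) (pG : p.-group G).
Hypotheses (cycZ : cyclic 'Z(G)) (Zz : z \in 'Z(G)) (oz : #[z] = p).
Hypothesis autG_inner :
  forall a : {perm gT}, a \in Aut G -> #[a] = p -> a \in Inn G.
Hypothesis Phiz : z \in 'Phi(G).

Local Notation Phi := 'Phi(G).
Local Notation W := 'Ohm_1('Z(Phi)).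
Implicit Types (f F : gT -> 'F_p) (u v : gT).

Lemma W_normal : W <| G.
Proof. by do 2 apply: gFnormal_trans; apply: Phi_normal. Qed.

Lemma W_abelem : p.-abelem W.
Proof.
have pPhi : p.-group 'Z(Phi) := pgroupS (subset_trans (center_sub _) (Phi_sub G)) pG.
exact: Ohm1_abelem pPhi (center_abelian _).
Qed.

Lemma mem_W x : x \in 'Z(Phi) -> x ^+ p = 1 -> x \in W.
Proof.
move=> Zx xp; have pPhi : p.-group 'Z(Phi) := pgroupS (subset_trans (center_sub _) (Phi_sub G)) pG.
by have /= -> := OhmE 1 pPhi; rewrite mem_gen // !inE -in_setI Zx expn1 xp eqxx.
Qed.

Lemma W_ZPhi : W \subset 'Z(Phi). Proof. exact: Ohm_sub. Qed.

Lemma W_Phi : W \subset Phi.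
Proof. exact: subset_trans W_ZPhi (center_sub _). Qed.

Lemma W_G : W \subset G.
Proof. exact: subset_trans W_Phi (Phi_sub G). Qed.

Lemma W_expp x : x \in W -> x ^+ p = 1.
Proof. by have [_ h] := abelemP p_pr W_abelem; apply: h. Qed.

Lemma W_comm x y : x \in W -> y \in Phi -> commute x y.
Proof. by move/(subsetP W_ZPhi)/centerP=> [_ h]; apply: h. Qed.

Lemma Zp_W c : c \in 'Z(G) -> c ^+ p = 1 -> c \in W.
Proof.
move=> Zc cp; have zc := central_expp p_pr pG cycZ Zz oz Zc cp.
apply: mem_W => //; apply/centerP; have /centerP[_ cG] := Zc.
split; first by apply: subsetP zc; rewrite cycle_subG.
by move=> y Phiy; apply: cG; apply: subsetP (Phi_sub G) _ Phiy.
Qed.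

Lemma W_z : z \in W.
Proof. by apply: Zp_W => //; rewrite -oz expg_order. Qed.

Lemma PhiJ x g : x \in Phi -> g \in G -> x ^ g \in Phi.
Proof. by move=> Px Gg; rewrite memJ_norm // (subsetP (normal_norm (Phi_normal G))). Qed.

Lemma WJ x g : x \in W -> g \in G -> x ^ g \in W.
Proof. by move=> Px Gg; rewrite memJ_norm // (subsetP (normal_norm W_normal)). Qed.

Variable chi : gT -> 'F_p.
Hypotheses (chiM : additive_on W chi) (chiz : chi z = 1%R).

Local Notation rep := (represented G W chi).
Local Notation del F g := (fun h => F (g * h)%g - F h)%R.

(* The commutators [[~ u, g]] are those of an element represented by [F]; for [u] in [W] this
   says that [F - chi (u ^ _)] is constant. *)
Definition realizes (u : gT) (F : gT -> 'F_p) := {in G, forall g, [~ u, g] \in W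
  /\ {in G, forall h, chi ([~ u, g] ^ h)%g = (F (g * h)%g - F h)%R}}.

Definition Phi_invariant (F : gT -> 'F_p) := {in Phi & G, forall x h, F (x * h)%g = F h}.

Lemma W_faithful : {in W, forall x, {in G, forall h, chi (x ^ h) = 0%R} -> x = 1}.
Proof.
apply: (additive_faithful (z := z) p_pr pG cycZ Zz oz W_normal chiM).
by rewrite chiz; apply: GRing.oner_neq0.
Qed.

Lemma W_inj x y : x \in W -> y \in W ->
  {in G, forall h, chi (x ^ h) = chi (y ^ h)} -> x = y.
Proof. exact: chi_inj W_normal chiM W_faithful x y. Qed.

Lemma const_central x : x \in W ->
  {in G, forall h, chi (x ^ h) = chi x} -> x \in 'Z(G).
Proof.
move=> Wx xc; apply/centerP; split=> [|g Gg]; first exact: subsetP W_G _ Wx.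
apply/commgP/conjg_fixP/W_inj => //; first exact: WJ.
by move=> h Gh; rewrite -conjgM !xc ?groupM.
Qed.

Lemma Phi_invariantP F : Phi_invariant F ->
  {in G, forall g, {in Phi & G, forall x h, F (g * (x * h))%g = F (g * h)%g}}.
Proof.
move=> Finv g Gg x h Px Gh.
have -> : g * (x * h) = x ^ g^-1 * (g * h) by rewrite (mulgA g) (conjgCV g x) -(mulgA (x ^ g^-1)).
by rewrite (Finv (x ^ g^-1)) ?PhiJ ?groupV ?groupM.
Qed.

Lemma additive_invariant f : additive_on G f -> Phi_invariant f.
Proof.
move=> fM x h Px Gh; have Gx : x \in G := subsetP (Phi_sub G) x Px.
by rewrite (fM x h Gx Gh) (additive_Phi p_pr pG fM Px) add0r.
Qed.

Lemma rep_const c : rep (fun=> c).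
Proof. exact: (represented_central chiM W_z Zz chiz). Qed.

Lemma realize_W F :
    {in G, forall g, rep (del F g)} ->
    {in W & G, forall x h, (F (x * h)%g - F h)%R = (F x - F 1%g)%R} ->
    {in W, forall x, x \in 'Z(G) -> {in G, forall h, F (x * h)%g = F h}} ->
  exists2 u, u \in G & realizes u F.
Proof.
move=> repF FW FZ.
apply: (realize_inner p_pr p_odd autG_inner W_normal W_abelem chiM W_faithful) => //.
by move=> x Wx xc; apply: FZ => //; apply: const_central.
Qed.

Lemma realize_invariant F : Phi_invariant F ->
  {in G, forall g, rep (del F g)} -> exists2 u, u \in G & realizes u F.
Proof.
move=> Finv repF; have sW := subsetP W_Phi; apply: realize_W => // x.
  by move=> h Wx Gh; rewrite -{2}[x]mulg1 !Finv ?sW ?subrr.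
by move=> Wx _ h Gh; rewrite Finv ?sW.
Qed.

(** This lemma and the next three form a dictionary: [[~ u, g]] is trivial exactly when the
    difference of [F] at [g] is zero, and central exactly when it is constant. *)
Lemma realizes_comm u F g : realizes u F -> g \in G ->
  {in G, forall h, F (g * h)%g = F h} -> [~ u, g] = 1.
Proof.
move=> uF Gg gF; have [Wug ug] := uF g Gg.
by apply: W_faithful => // h Gh; rewrite ug // gF // subrr.
Qed.

Lemma comm_realizes u F g h : realizes u F -> g \in G -> h \in G ->
  [~ u, g] = 1 -> F (g * h)%g = F h.
Proof.
move=> uF Gg Gh ug1; have [_ ug] := uF g Gg.
by apply/eqP; rewrite -subr_eq0 -ug // ug1 conj1g (additive1 chiM).
Qed.

Lemma realizes_central u F g c : realizes u F -> g \in G ->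
  {in G, forall h, (F (g * h)%g - F h)%R = c} -> [~ u, g] \in 'Z(G).
Proof.
move=> uF Gg gF; have [Wug ug] := uF g Gg.
apply: const_central => // h Gh; rewrite ug // gF //.
by rewrite -[in RHS](conjg1 [~ u, g]) ug // gF.
Qed.

Lemma central_realizes u F g h : realizes u F -> g \in G -> h \in G ->
  [~ u, g] \in 'Z(G) -> (F (g * h)%g - F h)%R = (F g - F 1%g)%R.
Proof.
move=> uF Gg Gh /centerP[_ cug]; have [_ ug] := uF g Gg.
rewrite -ug // conjgE (cug h Gh) mulKg.
by rewrite -[in LHS](conjg1 [~ u, g]) ug // mulg1.
Qed.

(** In [[~ u * v, g] = [~ u, g] ^ v * [~ v, g]], conjugation by [v] shifts the argument of the
    difference of [F1]; the last hypothesis says that this has no effect. *)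
Lemma realizes_mul u v F1 F2 : u \in G -> v \in G ->
    realizes u F1 -> realizes v F2 ->
    {in G &, forall g h, (F1 (g * (v * h))%g - F1 (v * h)%g = F1 (g * h)%g - F1 h)%R} ->
  realizes (u * v) (fun h => F1 h + F2 h)%R.
Proof.
move=> Gu Gv uF vF F1v g Gg; have [Wu ug] := uF g Gg; have [Wv vg] := vF g Gg.
rewrite commMgJ groupM ?WJ //; split=> // h Gh.
have Gvh := groupM Gv Gh.
rewrite conjMg -conjgM (chiM (WJ Wu Gvh) (WJ Wv Gh)) ug // vg // F1v //; ring.
Qed.

Lemma realizes_exp u F n : u \in G -> realizes u F ->
    {in G &, forall g h, (F (g * (u * h))%g - F (u * h)%g = F (g * h)%g - F h)%R} ->
  realizes (u ^+ n) (fun h => n%:R * F h)%R.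
Proof.
move=> Gu uF Fu; elim: n => [|n IHn] g Gg.
  rewrite expg0 comm1g group1; split=> // h Gh.
  by rewrite conj1g (additive1 chiM) !mul0r subrr.
have nFu : {in G &, forall g h,
    (n%:R * F (g * (u * h))%g - n%:R * F (u * h)%g = n%:R * F (g * h)%g - n%:R * F h)%R}.
  by move=> x h Gx Gh; rewrite -!mulrBr Fu.
have [Wg gE] := realizes_mul (groupX n Gu) Gu IHn uF nFu Gg.
rewrite expgSr; split=> // h Gh; rewrite gE // -natr1; ring.
Qed.

Lemma realizes_mulZ u c F : u \in G -> c \in 'Z(G) -> realizes u F -> realizes (u * c) F.
Proof.
move=> Gu Zc uF g Gg; have [Wu ug] := uF g Gg; have /centerP[Gc cG] := Zc.
have cg1 : [~ c, g] = 1 by apply/eqP/commgP/cG.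
have Gug : [~ u, g] \in G by rewrite groupR.
by rewrite commMgJ cg1 mulg1 conjgE -(cG _ Gug) mulKg.
Qed.

Lemma realizes_W x : x \in W -> realizes x (fun h => chi (x ^ h)).
Proof.
move=> Wx g Gg; rewrite commgEl groupM ?groupV ?WJ //; split=> // h Gh.
have Ggh := groupM Gg Gh.
rewrite conjMg conjVg -conjgM (chiM (groupVr (WJ Wx Gh)) (WJ Wx Ggh)).
by rewrite (additiveV chiM (WJ Wx Gh)) addrC.
Qed.

Lemma rep_invariant_commute x r : r \in G -> x \in W ->
  {in G, forall h, chi (x ^ (r * h)) = chi (x ^ h)} -> x \in 'C_W[r].
Proof.
move=> Gr Wx xr; apply/setIP; split=> //; apply/cent1P/commgP/conjg_fixP.
by apply: W_inj => // [|h Gh]; rewrite ?WJ // -conjgM xr.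
Qed.

(** The larger module [X = <r> C_W(r)] is still normal and elementary abelian, and [F] itself is
    represented there, so differences of [F2] may involve [F]. The commutators of [u] lie in [X]
    rather than in [W], so the conclusion is not phrased with [realizes]. *)
Lemma realize_ext r F F2 : r \in G -> r ^+ p = 1 -> realizes r F ->
    {in G, forall g, commute r [~ r, g]} ->
    {in G, forall g, exists c, exists Q, [/\ rep Q, {in G, forall h, Q (r * h)%g = Q h}
       & {in G, forall h, (F2 (g * h)%g - F2 h = c * F h + Q h)%R}]} ->
    {in G, forall h, F2 (r * h)%g = F2 h} ->
    {in 'C_W[r], forall x, {in G, forall h, F2 (x * h)%g = F2 h}} ->
  exists2 u, u \in G & [/\ {in G, forall g, {in G, forall h, F2 (g * h)%g = F2 h} -> [~ u, g] = 1}
    & {in G &, forall g h, [~ u, g] \in 'Z(G) -> (F2 (g * h)%g - F2 h = F2 g - F2 1%g)%R}].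
Proof.
move=> Gr rp rF rcomm delF2 F2r F2W.
pose C := 'C_W[r]%G; pose X := (<[r]> <*> C)%G.
have sCW : C \subset W by apply: subsetIl.
have Crg g : g \in G -> [~ r, g] \in C.
  move=> Gg; have [Wrg _] := rF g Gg; apply/setIP; split=> //.
  by apply/cent1P/esym; apply: rcomm.
have cRC : <[r]> \subset 'C(C).
  by rewrite cycle_subG; apply/centP=> x /setIP[_ /cent1P/esym].
have defX : X :=: <[r]> * C by rewrite /= norm_joinEl // cents_norm.
have abW : abelian W := abelem_abelian W_abelem.
have abC : abelian C := abelianS sCW abW.
have CJ c g : c \in C -> g \in G -> c ^ g \in C.
  move=> Cc Gg; have [Wc /cent1P cr] := setIP Cc.
  apply/setIP; split; [exact: WJ | apply/cent1P].
  have Gg' := groupVr Gg.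
  rewrite -[r](conjgKV g) /commute -!conjMg; congr (_ ^ g); rewrite conjg_mulR.
  have [Wrg _] := setIP (Crg _ Gg').
  have cw : commute c [~ r, g^-1] by apply: (centsP abW).
  exact: commuteM.
have sCX : C \subset X by apply: joing_subr.
have sCX' := subsetP sCX.
have Xr : r \in X by rewrite mem_gen // inE cycle_id.
have sXG : X \subset G by rewrite join_subG cycle_subG Gr (subset_trans sCW W_G).
have nXG : X <| G.
  apply/andP; split=> //; apply/normsP=> g Gg; apply/eqP.
  rewrite eqEcard cardJg leqnn andbT; apply/subsetP=> _ /imsetP[x Xx ->].
  have /mulsgP[_ c /cycleP[i ->] Cc ->] : x \in <[r]> * C by rewrite -defX.
  rewrite conjMg conjXg conjg_mulR.
  by rewrite (groupM (groupX _ (groupM Xr (sCX' _ (Crg g Gg)))) (sCX' _ (CJ _ _ Cc Gg))).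
have abelX : p.-abelem X.
  apply/(abelemP p_pr); split; first by rewrite abelianY cycle_abelian abC centsC.
  move=> x; rewrite defX => /mulsgP[_ c /cycleP[i ->] Cc ->].
  rewrite expgMn; last by apply: (centsP cRC); rewrite ?mem_cycle.
  by rewrite -expgM mulnC expgM rp expg1n mul1g W_expp // (subsetP sCW).
have chiC : additive_on C chi by move=> x y Cx Cy; rewrite chiM ?(subsetP sCW).
have [chi' chi'M eq_chi] := extend_additive abelX sCX chiC.
have Cz : z \in C.
  apply/setIP; split; [exact: W_z | apply/cent1P]; have /centerP[_ cz] := Zz; exact: cz.
(* As [r ^ h = r * [~ r, h]], the function of [r] is [F] up to a constant, which a power of [z]
   absorbs. *)
have XF : represented G X chi' F.
  have repc := represented_central chi'M (subsetP sCX z Cz) Zz.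
  rewrite eq_chi // in repc.
  have rep1 : represented G X chi' (fun h => chi' r + (F h - F 1%g))%R.
    exists r => // h Gh; have Ch := Crg h Gh.
    rewrite conjg_mulR (chi'M _ _ Xr (sCX' _ Ch)) (eq_chi _ Ch).
    have [_ rh] := rF h Gh; have := rh 1 (group1 G).
    by rewrite conjg1 mulg1 => ->.
  apply: represented_ext (represented_sub nXG chi'M rep1 (repc chiz (chi' r - F 1%g)%R)).
  by move=> h _ /=; ring.
have XQ Q : rep Q -> {in G, forall h, Q (r * h)%g = Q h} -> represented G X chi' Q.
  move=> [x Wx xQ] Qr; have Cx : x \in C.
    by apply: rep_invariant_commute => // h Gh; rewrite !xQ ?groupM ?Qr.
  exists x => [|h Gh]; first exact: subsetP Cx.
  by rewrite eq_chi ?CJ // xQ.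
have F2X : {in X, forall x, {in G, forall h, F2 (x * h)%g = F2 h}}.
  move=> x; rewrite defX => /mulsgP[_ c /cycleP[i ->] Cc ->] h Gh.
  have Gch : c * h \in G by rewrite groupM // (subsetP W_G) // (subsetP sCW).
  rewrite -mulgA -(F2W c Cc h Gh); elim: i => [|i IHi]; first by rewrite mul1g.
  by rewrite expgS -mulgA F2r // groupM ?groupX.
have faithX := additive_faithful (z := z) p_pr pG cycZ Zz oz nXG chi'M.
rewrite eq_chi // chiz GRing.oner_neq0 in faithX; move/(_ isT) in faithX.
have [|x h Xx Gh|x Xx _ h Gh|u Gu uF2] :=
  @realize_inner _ G X p chi' F2 p_pr p_odd autG_inner nXG abelX chi'M faithX.
- move=> g Gg; have [c [Q [rQ Qr dF]]] := delF2 g Gg.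
  apply: represented_ext
    (represented_add nXG chi'M (represented_scale nXG chi'M c XF) (XQ Q rQ Qr)).
  by move=> h Gh /=; rewrite dF.
- by rewrite -[x in RHS]mulg1 !F2X ?subrr.
- by rewrite F2X.
exists u => //; split=> [g Gg gF2 | g h Gg Gh /centerP[_ cug]]; have [Xug ug] := uF2 g Gg.
  by apply: faithX => // h Gh; rewrite ug // gF2 // subrr.
rewrite -ug // conjgE (cug h Gh) mulKg.
by rewrite -[in LHS](conjg1 [~ u, g]) ug // mulg1.
Qed.

(** * Elements realizing additive functions *)

Lemma two_neq0 : (2%:R != 0 :> 'F_p)%R.
Proof. by rewrite natFp_eq0 // gtnNdvd // odd_prime_gt2. Qed.

Lemma realize_additive f : additive_on G f -> exists2 u, u \in G & realizes u f.
Proof.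
move=> fM; apply: realize_invariant; first exact: additive_invariant.
move=> g Gg; apply: represented_ext (rep_const (f g)) => h Gh /=.
by rewrite fM //; ring.
Qed.

Lemma additive_central y f g :
  additive_on G f -> realizes y f -> g \in G -> [~ y, g] \in 'Z(G).
Proof.
move=> fM yf Gg; apply: (realizes_central (c := f g) yf) => // h Gh.
by rewrite fM //; ring.
Qed.

Lemma additive_comm y f g : additive_on G f -> realizes y f -> g \in G ->
  ([~ y, g] == 1) = (f g == 0%R).
Proof.
move=> fM yf Gg; apply/eqP/eqP=> [yg1 | fg0].
  by have := comm_realizes yf Gg (group1 G) yg1; rewrite mulg1 (additive1 fM).
by apply: (realizes_comm yf Gg) => h Gh; rewrite fM // fg0 add0r.
Qed.

(* Then [(v * c^-1) ^+ p = 1]. If [v ^+ p] is central but [v] is not adjustable, then [v ^+ p]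
   generates the cyclic group ['Z(G)], so any [u] can be corrected by a power of [v] instead. *)
Definition adjustable v := exists2 c, c \in 'Z(G) & v ^+ p = c ^+ p.

Lemma adjustable_dec v : adjustable v \/ ~ adjustable v.
Proof.
have [/existsP[c /andP[Zc /eqP vc]] | nov] :=
  boolP [exists c, (c \in 'Z(G)) && (v ^+ p == c ^+ p)]; first by left; exists c.
by right=> -[c Zc vc]; case/existsP: nov; exists c; rewrite Zc vc eqxx.
Qed.

Lemma adjustable_order_p v F : v \in G -> realizes v F -> adjustable v ->
  exists r, [/\ r \in G, r ^+ p = 1, realizes r F & exists2 c, c \in 'Z(G) & r = v * c].
Proof.
move=> Gv vF [c Zc vc]; have Zc' : c^-1 \in 'Z(G) by rewrite groupV.
have /centerP[Gc' cc] := Zc'; exists (v * c^-1); split.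
- exact: groupM.
- by rewrite expgMn ?vc -?expgMn ?mulgV ?expg1n //; [apply/commuteV | apply/esym/cc].
- exact: realizes_mulZ.
by exists c^-1.
Qed.

(** Here [(u * v ^+ j) ^+ p = u ^+ p * v ^+ (j * p)], and [v ^+ p] generates ['Z(G)], so some [j]
    cancels [u ^+ p]. *)
Lemma order_p_mul u v : u \in G -> v \in G -> u ^+ p \in 'Z(G) -> v ^+ p \in 'Z(G) ->
  [~ v, u] \in 'Z(G) -> [~ v, u] ^+ p = 1 -> ~ adjustable v -> exists j, (u * v ^+ j) ^+ p = 1.
Proof.
move=> Gu Gv Zup Zvp Zvu vup badv.
have badv' : {in 'Z(G), forall c, v ^+ p <> c ^+ p} by move=> c Zc vc; case: badv; exists c.
have [j uvj] := complete_power p_pr pG cycZ Zup Zvp badv'; exists j.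
have /centerP[_ cvu] := Zvu.
have vju : [~ v ^+ j, u] = [~ v, u] ^+ j by apply: commXg; apply/esym/cvu.
rewrite (expp_mul p_pr p_odd) -?expgM ?uvj //; rewrite vju.
- by apply/commuteX/esym/cvu.
- by apply/commuteX/commute_sym/commuteX/cvu.
by rewrite expgAC vup expg1n.
Qed.

(** The difference of [F ^ 2] at [g] is [2 F(g) F + F(g) ^ 2], so some [u] realizes [F ^ 2] over
    [<r> C_W(r)]. As [s] realizes an additive function, [[~ u, s]] is central; hence [2 F(s) F] is
    constant, and comparing its values at [s] and [1] gives [F s = 0]. *)
Lemma additive_realizers r F s f : r \in G -> r ^+ p = 1 -> additive_on G F ->
  realizes r F -> s \in G -> additive_on G f -> realizes s f -> F s = 0%R.
Proof.
move=> Gr rp FM rF Gs fM sf; apply/eqP; apply: contraT => Fs.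
have Fr : F r = 0%R by apply/eqP; rewrite -(additive_comm FM rF Gr) commgg.
have rC g : g \in G -> commute r [~ r, g].
  by move=> Gg; have /centerP[_ h] := additive_central FM rF Gg; apply/esym/h.
pose F2 h := (F h * F h)%R.
have delF2 g h : g \in G -> h \in G ->
    (F2 (g * h)%g - F2 h = 2%:R * F g * F h + F g * F g)%R.
  by move=> Gg Gh; rewrite /F2 FM //; ring.
have [||x /setIP[Wx _] h Gh|u Gu [_ uZ]] := realize_ext (F2 := F2) Gr rp rF rC.
- move=> g Gg; exists (2%:R * F g)%R, (fun=> F g * F g)%R; split=> // [|h Gh].
    exact: rep_const.
  exact: delF2.
- by move=> h Gh; rewrite /F2 FM // Fr add0r.
- by rewrite /F2 (additive_invariant FM) // (subsetP W_Phi).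
have /(uZ s s Gs Gs) : [~ u, s] \in 'Z(G).
  by rewrite -invg_comm groupV (additive_central fM).
rewrite delF2 // -[s in RHS]mulg1 delF2 // (additive1 FM) => /eqP.
rewrite -subr_eq0 mulr0 add0r addrK !mulf_eq0 !(negPf Fs) !orbF.
by rewrite (negPf two_neq0).
Qed.

(** For [y] outside [Phi], take an additive [f2] with [f2 y <> 0], realized by [y2]. The preceding
    lemma then gives a contradiction, applied to a central correction of [y] if [y] is adjustable
    and to some [y2 * y ^+ j] of exponent [p] otherwise. *)
Lemma additive_realizer_Phi y f :
  additive_on G f -> y \in G -> realizes y f -> y \in Phi.
Proof.
move=> fM Gy yf; apply: contraT => Phi'y.
have [f2 f2M f2y] := separate_Phi p_pr pG Gy Phi'y.
have [y2 Gy2 y2f] := realize_additive f2M.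
have yp v F : v \in G -> additive_on G F -> realizes v F -> v ^+ p \in 'Z(G).
  move=> Gv FM vF; apply/centerP; split=> [|g Gg]; first exact: groupX.
  have [Wvg _] := vF g Gg; have /centerP[_ cvg] := additive_central FM vF Gg.
  apply/commgP; rewrite commXg; last exact/esym/cvg.
  by rewrite W_expp.
case: (adjustable_dec y) => [gy | bady].
  have [r [Gr rp rf _]] := adjustable_order_p Gy yf gy.
  have fy2 := additive_realizers Gr rp fM rf Gy2 f2M y2f.
  case: f2y; apply/eqP; rewrite -(additive_comm f2M y2f Gy) -invg_comm invg_eq1.
  by rewrite (additive_comm fM yf Gy2) fy2.
have [Wyy2 _] := yf y2 Gy2.
have [j rp] := order_p_mul Gy2 Gy (yp _ _ Gy2 f2M y2f) (yp _ _ Gy fM yf)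
  (additive_central fM yf Gy2) (W_expp Wyy2) bady.
have fdel (F : gT -> 'F_p) v : additive_on G F -> v \in G -> {in G &, forall g h,
    (F (g * (v * h))%g - F (v * h)%g = F (g * h)%g - F h)%R}.
  by move=> FM Gv g h Gg Gh; rewrite !FM ?groupM //; ring.
have yjf := realizes_exp j Gy yf (fdel f y fM Gy).
have Gyj := groupX j Gy.
have rf := realizes_mul Gy2 Gyj y2f yjf (fdel f2 _ f2M Gyj).
have FM : additive_on G (fun h => f2 h + j%:R * f h)%R.
  by move=> g h Gg Gh /=; rewrite fM // f2M //; ring.
have := additive_realizers (groupM Gy2 Gyj) rp FM rf Gy fM yf.
have /eqP -> : f y == 0%R by rewrite -(additive_comm fM yf Gy) commgg.
by rewrite mulr0 addr0 => /f2y.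
Qed.

(** For [u] outside [Phi], an additive function nonzero at [u] is realized by an element of [Phi],
    which does not commute with [u]. *)
Lemma cent_Phi u : u \in G -> u \in 'C(Phi) -> u \in 'Z(Phi).
Proof.
move=> Gu cu; rewrite inE cu andbT; apply: contraT => Phi'u.
have [f fM fu] := separate_Phi p_pr pG Gu Phi'u.
have [y Gy yf] := realize_additive fM.
have Phiy := additive_realizer_Phi fM Gy yf.
case: fu; apply/eqP; rewrite -(additive_comm fM yf Gu).
by apply/commgP/esym/(centP cu).
Qed.

(** * Functions realized in the center of [Phi] *)

Definition derivable F := Phi_invariant F /\ {in G, forall g, rep (del F g)}.

Lemma realizes_ZPhi u F : u \in G -> Phi_invariant F -> realizes u F -> u \in 'Z(Phi).
Proof.
move=> Gu Finv uF; apply: cent_Phi => //; apply/centP=> x Px.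
apply/commgP/eqP; apply: (realizes_comm uF) => [|h Gh]; last exact: Finv.
exact: subsetP (Phi_sub G) x Px.
Qed.

Lemma realizes_expp u F : u \in Phi -> realizes u F -> u ^+ p \in 'Z(G).
Proof.
move=> Pu uF; have Gu := subsetP (Phi_sub G) u Pu.
apply/centerP; split=> [|g Gg]; first exact: groupX.
have [Wug _] := uF g Gg; apply/commgP; rewrite commXg ?W_expp //.
by apply/esym; apply: W_comm.
Qed.

Lemma realizes_rep x F : x \in W -> realizes x F -> rep F.
Proof.
move=> Wx xF; have repx : rep (fun h => chi (x ^ h)) by exists x.
apply: represented_ext (represented_add W_normal chiM repx (rep_const (F 1%g - chi x)%R)).
move=> h Gh /=; have [_ xh] := xF h Gh; have [_ xh'] := realizes_W Wx Gh.
have := xh 1 (group1 G); rewrite xh' // mulg1 conjg1 => e.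
by rewrite -[F h](subrK (F 1%g)) -e; ring.
Qed.

Lemma invariant_shift F : Phi_invariant F -> {in Phi, forall v, {in G &, forall g h,
  (F (g * (v * h))%g - F (v * h)%g = F (g * h)%g - F h)%R}}.
Proof. by move=> Finv v Pv g h Gg Gh; rewrite (Phi_invariantP Finv) // (Finv v). Qed.

(** The central correction of [u] has trivial [p]-th power and still centralizes [Phi], so it lies
    in [W]. *)
Lemma adjustable_represented u F : u \in 'Z(Phi) -> realizes u F -> adjustable u -> rep F.
Proof.
move=> Zu uF gu; have Gu : u \in G.
  by apply: (subsetP (Phi_sub G)); case/centerP: Zu.
have [r [Gr rp rF [c Zc rE]]] := adjustable_order_p Gu uF gu.
apply: realizes_rep rF; apply: mem_W => //.
have /centerP[Gc cG] := Zc; apply: cent_Phi => //; rewrite rE groupM //.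
  by case/setIP: Zu.
apply/centP=> x Px; apply: cG; exact: subsetP (Phi_sub G) x Px.
Qed.

(** Modulo represented functions, the derivable ones have dimension at most one: [u1] is not
    adjustable, so some [u2 * u1 ^+ j] has trivial [p]-th power, lies in [W], and makes [F2 + j F1]
    represented. *)
Lemma derivable_dichotomy F1 F2 : derivable F1 -> derivable F2 -> ~ rep F1 ->
  exists k, rep (fun h => F2 h - k * F1 h)%R.
Proof.
move=> [F1inv dF1] [F2inv dF2] nrF1.
have [u1 Gu1 u1F] := realize_invariant F1inv dF1.
have [u2 Gu2 u2F] := realize_invariant F2inv dF2.
have Zu1 := realizes_ZPhi Gu1 F1inv u1F; have Zu2 := realizes_ZPhi Gu2 F2inv u2F.
have /centerP[Pu1 cu1] := Zu1; have /centerP[Pu2 cu2] := Zu2.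
have u12 : [~ u1, u2] = 1 by apply/eqP/commgP/cu1.
have Z12 : [~ u1, u2] \in 'Z(G) by rewrite u12 group1.
have bad1 : ~ adjustable u1 by move=> gu1; apply: nrF1; apply: adjustable_represented gu1.
have [|j rp] := order_p_mul Gu2 Gu1 (realizes_expp Pu2 u2F) (realizes_expp Pu1 u1F) Z12 _ bad1.
  by rewrite u12 expg1n.
have u1jF := realizes_exp j Gu1 u1F (invariant_shift F1inv Pu1).
have rF := realizes_mul Gu2 (groupX j Gu1) u2F u1jF (invariant_shift F2inv (groupX j Pu1)).
exists (- j%:R)%R; apply: represented_ext (realizes_rep _ rF) => [h Gh /= | ]; first by ring.
by apply: mem_W => //; rewrite groupM ?groupX.
Qed.

Lemma not_rep_unique F k : ~ rep F -> rep (fun h => k * F h)%R -> k = 0%R.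
Proof.
move=> nrF rkF; apply/eqP; apply: contraT => nzk; case: nrF.
apply: represented_ext (represented_scale W_normal chiM k^-1%R rkF) => h Gh /=.
by rewrite mulrA mulVf // mul1r.
Qed.

Lemma derivable_additive f : additive_on G f -> derivable f.
Proof.
move=> fM; split=> [|g Gg]; first exact: additive_invariant.
apply: represented_ext (rep_const (f g)) => h Gh /=.
by rewrite fM //; ring.
Qed.

Lemma derivable_mul f1 f2 : additive_on G f1 -> additive_on G f2 -> rep f1 -> rep f2 ->
  derivable (fun h => f1 h * f2 h)%R.
Proof.
move=> f1M f2M rf1 rf2; split=> [x h Px Gh | g Gg].
  by rewrite /= (additive_invariant f1M) ?(additive_invariant f2M).
have rD := represented_add W_normal chiM; have rS := represented_scale W_normal chiM.
apply: represented_ext (rD _ _ (rD _ _ (rS (f1 g) _ rf2) (rS (f2 g) _ rf1))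
  (rep_const (f1 g * f2 g)%R)) => h Gh /=.
by rewrite f1M // f2M //; ring.
Qed.

(** * Quadratic functions and their realizing elements *)

(** [F] is quadratic with a possibly asymmetric polar form [b]; its difference at [g] is [b g] plus
    a constant. *)
Definition datum w F b := [/\ w \in G, realizes w F, biadditive_on G b,
  {in G &, forall g h, F (g * h)%g = (F g + F h + b g h)%R}
  & {in G, forall g, rep (b g)}].

Lemma biadditive_Phi (b : gT -> gT -> 'F_p) x h : biadditive_on G b -> x \in Phi ->
  h \in G -> (b x h = 0 /\ b h x = 0)%R.
Proof.
move=> [bMr bMl] Px Gh.
by rewrite (additive_Phi p_pr pG (bMr h Gh)) ?(additive_Phi p_pr pG (bMl h Gh)).
Qed.

Lemma datum_Phi w F b x h : datum w F b -> x \in Phi -> h \in G ->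
  F (x * h) = (F x + F h)%R.
Proof.
move=> [_ _ bM FM _] Px Gh; have Gx := subsetP (Phi_sub G) x Px.
by have [b0 _] := biadditive_Phi bM Px Gh; rewrite FM // b0 addr0.
Qed.

(* Otherwise the element of [Phi] realizing [f ^ 2] has a noncentral commutator with [w]. *)
Lemma additive_datum0 w F b f : datum w F b -> additive_on G f -> rep f -> f w = 0%R.
Proof.
move=> dw fM rf; have [Gw wF bM FM _] := dw.
have [sqinv sqrep] := derivable_mul fM fM rf rf.
have [u Gu uf] := realize_invariant sqinv sqrep.
have /centerP[Pu _] := realizes_ZPhi Gu sqinv uf.
have Zwu : [~ w, u] \in 'Z(G).
  apply: (realizes_central (c := F u) wF) => // h Gh.
  by rewrite (datum_Phi dw) //; ring.
have Zuw : [~ u, w] \in 'Z(G) by rewrite -invg_comm groupV.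
have := central_realizes uf Gw Gw Zuw; rewrite /= fM // (additive1 fM) => e.
have: (2%:R * (f w * f w) = 0)%R.
  transitivity ((f w + f w) * (f w + f w) - f w * f w - (f w * f w - 0 * 0))%R; first by ring.
  by rewrite e subrr.
by move/eqP; rewrite !mulf_eq0 (negPf two_neq0) orbb => /eqP.
Qed.

Lemma rep_dec F : rep F \/ ~ rep F.
Proof.
have [/existsP[x /andP[Wx /forall_inP xF]] | nrF] :=
  boolP [exists x, (x \in W) && [forall h in G, chi (x ^ h) == F h]].
  by left; exists x => // h Gh; apply/eqP/xF.
right=> -[x Wx xF]; case/existsP: nrF; exists x; rewrite Wx /=.
by apply/forall_inP=> h Gh; rewrite xF.
Qed.

Lemma additive_dec f : additive_on G f \/ ~ additive_on G f.
Proof.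
have [/forall_inP fM | nfM] :=
  boolP [forall g in G, [forall h in G, f (g * h) == (f g + f h)%R]].
  by left=> g h Gg Gh; have /forall_inP/(_ h Gh)/eqP := fM g Gg.
right=> fM; case/negP: nfM; apply/forall_inP=> g Gg; apply/forall_inP=> h Gh.
by rewrite fM.
Qed.

(** The search runs over finite functions, so [P] has to respect pointwise equality. *)
Lemma search_additive (P : (gT -> 'F_p) -> Prop) :
    (forall f, P f \/ ~ P f) -> (forall f1 f2, f1 =1 f2 -> P f1 -> P f2) ->
  (exists2 f, additive_on G f & P f) \/ (forall f, additive_on G f -> ~ P f).
Proof.
move=> decP extP.
have [|[f [fM Pf]] | noP] :=
  @fin_search {ffun gT -> 'F_p} (fun f : {ffun gT -> 'F_p} => additive_on G f /\ P f).
- by move=> f; case: (additive_dec f) (decP f) => ? [] ?; [left | right=> -[] ..].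
- by left; exists f.
right=> f fM Pf; case: (noP (finfun f)); split; last by apply: extP Pf => h; rewrite ffunE.
by move=> g h Gg Gh; rewrite !ffunE fM.
Qed.

Lemma datum_comm w F b x : datum w F b -> F 1 = 0%R -> x \in Phi ->
  ([~ w, x] == 1) = (F x == 0%R).
Proof.
move=> dw F1 Px; have [Gw wF _ _ _] := dw; have Gx := subsetP (Phi_sub G) x Px.
apply/eqP/eqP=> [wx1 | Fx0].
  by have := comm_realizes wF Gx (group1 G) wx1; rewrite mulg1 F1.
by apply: (realizes_comm wF Gx) => h Gh; rewrite (datum_Phi dw) // Fx0 add0r.
Qed.

Lemma datum_central w F b x : datum w F b -> x \in Phi -> [~ w, x] \in 'Z(G).
Proof.
move=> dw Px; have [Gw wF _ _ _] := dw; have Gx := subsetP (Phi_sub G) x Px.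
apply: (realizes_central (c := F x) wF) => // h Gh.
by rewrite (datum_Phi dw) //; ring.
Qed.

(** The shift by [v] adds [b g v], which is zero because [b g] is additive and represented. This is
    what lets data be multiplied. *)
Lemma datum_shift w F b v Fv bv : datum w F b -> datum v Fv bv -> {in G &, forall g h,
  (F (g * (v * h))%g - F (v * h)%g = F (g * h)%g - F h)%R}.
Proof.
move=> [_ _ [bMr bMl] FM rb] dv g h Gg Gh; have [Gv _ _ _ _] := dv.
rewrite !(FM g) ?groupM // (bMr g Gg v h Gv Gh).
rewrite (additive_datum0 dv (bMr g Gg) (rb g Gg)); ring.
Qed.

Lemma datum_mul w1 F1 b1 w2 F2 b2 : datum w1 F1 b1 -> datum w2 F2 b2 ->
  datum (w1 * w2) (fun h => F1 h + F2 h)%R (fun g h => b1 g h + b2 g h)%R.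
Proof.
move=> d1 d2; have [G1 wF1 [br1 bl1] M1 rb1] := d1; have [G2 wF2 [br2 bl2] M2 rb2] := d2.
split; [exact: groupM | | split | |].
- exact: realizes_mul G1 G2 wF1 wF2 (datum_shift d1 d2).
- by move=> g Gg h k Gh Gk; rewrite (br1 g Gg h k Gh Gk) (br2 g Gg h k Gh Gk); ring.
- by move=> g Gg h k Gh Gk; rewrite (bl1 g Gg h k Gh Gk) (bl2 g Gg h k Gh Gk) /=; ring.
- by move=> g h Gg Gh; rewrite M1 // M2 //; ring.
by move=> g Gg; apply: (represented_add W_normal chiM (rb1 g Gg) (rb2 g Gg)).
Qed.

Lemma datum_exp w F b n : datum w F b ->
  datum (w ^+ n) (fun h => n%:R * F h)%R (fun g h => n%:R * b g h)%R.
Proof.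
move=> dw; have [Gw wF [br bl] FM rb] := dw.
split; [exact: groupX | | split | |].
- exact: realizes_exp Gw wF (datum_shift dw dw).
- by move=> g Gg h k Gh Gk; rewrite (br g Gg h k Gh Gk); ring.
- by move=> g Gg h k Gh Gk; rewrite (bl g Gg h k Gh Gk) /=; ring.
- by move=> g h Gg Gh; rewrite FM //; ring.
by move=> g Gg; apply: (represented_scale W_normal chiM _ (rb g Gg)).
Qed.

Lemma datum_additive y f : y \in G -> additive_on G f -> realizes y f ->
  datum y f (fun _ _ => 0%R).
Proof.
move=> Gy fM yf; split=> //.
- by split=> g Gg h k Gh Gk /=; rewrite addr0.
- by move=> g h Gg Gh; rewrite fM // addr0.
by move=> g Gg; apply: rep_const.
Qed.

(** For [c = [~ w, g]] in [W], the commutator [[~ c, w]] is central, so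
    [(w * c) ^+ p = w ^+ p * c ^+ p = w ^+ p]. *)
Lemma datum_expp w F b : datum w F b -> w ^+ p \in 'Z(G).
Proof.
move=> dw; have [Gw wF _ _ _] := dw.
apply/centerP; split=> [|g Gg]; first exact: groupX.
have [Wwg _] := wF g Gg; set c := [~ w, g] in Wwg.
have Pc : c \in Phi := subsetP W_Phi c Wwg.
have Zcw : [~ c, w] \in 'Z(G) by rewrite -invg_comm groupV (datum_central dw).
have /centerP[_ ccw] := Zcw; have Gc := subsetP W_G c Wwg.
have [Wwc _] := wF c Gc.
apply/commgP/conjg_fixP; rewrite conjXg conjg_mulR -/c.
have Wcw : [~ c, w] \in W by rewrite -invg_comm groupV.
by rewrite (expp_mul p_pr p_odd _ _ (W_expp Wcw)) ?(W_expp Wwg) ?mulg1 //; apply/esym/ccw.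
Qed.

Lemma datum_adjustable w F b : datum w F b -> adjustable w ->
  exists r, [/\ datum r F b, r ^+ p = 1 & exists2 c, c \in 'Z(G) & r = w * c].
Proof.
move=> [Gw wF bM FM rb] gw; have [r [Gr rp rF rE]] := adjustable_order_p Gw wF gw.
by exists r.
Qed.

Lemma datum_order_p_mul w1 F1 b1 w2 F2 b2 : datum w1 F1 b1 -> datum w2 F2 b2 ->
    w1 \in Phi \/ w2 \in Phi -> ~ adjustable w2 -> exists j, (w1 * w2 ^+ j) ^+ p = 1.
Proof.
move=> d1 d2 Pw bad2; have [G1 wF1 _ _ _] := d1; have [G2 wF2 _ _ _] := d2.
have [Wc _] := wF2 w1 G1.
apply: order_p_mul (datum_expp d1) (datum_expp d2) _ (W_expp Wc) bad2 => //.
by case: Pw => Pw; [exact: datum_central d2 _ | rewrite -invg_comm groupV (datum_central d1)].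
Qed.

Lemma central_comm_additive y : y \in G -> {in G, forall g, [~ y, g] \in <[z]>} ->
  exists2 f, additive_on G f & realizes y f.
Proof.
move=> Gy yz; have zZ := subsetP (_ : <[z]> \subset 'Z(G)); rewrite cycle_subG in zZ.
have zW := subsetP (_ : <[z]> \subset W); rewrite cycle_subG W_z in zW.
move/(_ Zz) in zZ; move/(_ isT) in zW.
have cyz g h : g \in G -> h \in G -> [~ y, g] ^ h = [~ y, g].
  move=> Gg Gh; have /centerP[_ c] := zZ _ (yz g Gg).
  by rewrite conjgE (c h Gh) mulKg.
have fM : additive_on G (fun g => chi [~ y, g]).
  by move=> g h Gg Gh; rewrite commgMJ cyz // chiM ?zW ?yz // addrC.
exists (fun g => chi [~ y, g]) => // g Gg; split; first exact/zW/yz.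
by move=> h Gh; rewrite cyz // fM //; ring.
Qed.

Lemma additive_comm_cycle y f g :
  additive_on G f -> realizes y f -> g \in G -> [~ y, g] \in <[z]>.
Proof.
move=> fM yf Gg; have [Wyg _] := yf g Gg.
apply: (central_expp p_pr pG cycZ Zz oz) (W_expp Wyg).
exact: additive_central fM yf Gg.
Qed.

(** The coefficient of [F] modulo represented functions is unique, so it inherits additivity in [g]
    from [T]. *)
Lemma coef_additive (T : gT -> gT -> 'F_p) (k F : gT -> 'F_p) : ~ rep F ->
    {in G &, forall g g', {in G, forall h, T (g * g')%g h = (T g h + T g' h)%R}} ->
    {in G, forall g, rep (fun h => T g h - k g * F h)%R} -> additive_on G k.
Proof.
move=> nrF TM rT g g' Gg Gg'; apply/eqP; rewrite -subr_eq0; apply/eqP.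
apply: (not_rep_unique nrF).
have rB := represented_sub W_normal chiM.
apply: represented_ext (rB _ _ (represented_add W_normal chiM (rT g Gg) (rT g' Gg'))
  (rT _ (groupM Gg Gg'))) => h Gh /=.
by rewrite TM //; ring.
Qed.

(** * Detecting elements of [Phi] outside [N] *)

Section Exponent.

Variable N : {group gT}.
Hypotheses (nNG : N <| G) (sNPhi : N \subset Phi) (sPhiGN : [~: Phi, G] \subset N).
Hypotheses (powN : {in G, forall g, g ^+ p \in N}) (Nz : z \in N).

Lemma realize_datum F b : biadditive_on G b ->
    {in G &, forall g h, F (g * h)%g = (F g + F h + b g h)%R} ->
    {in G, forall g, rep (b g)} -> {in N, forall n, F n = 0%R} ->
  exists w, datum w F b.
Proof.
move=> bM FM rb FN.
have Fx x h : x \in Phi -> h \in G -> (F (x * h)%g - F h)%R = F x.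
  move=> Px Gh; have Gx := subsetP (Phi_sub G) x Px.
  by have [b0 _] := biadditive_Phi bM Px Gh; rewrite FM // b0; ring.
have sWP := subsetP W_Phi.
have [||x Wx Zx h Gh|w Gw wF] := @realize_W F; last by exists w.
- move=> g Gg.
  apply: represented_ext (represented_add W_normal chiM (rb g Gg) (rep_const (F g))).
  by move=> h Gh /=; rewrite FM //; ring.
- by move=> x h Wx Gh; rewrite -[x in RHS]mulg1 !Fx ?sWP.
(* A central element of [W] is a power of [z], so it lies in [N], where [F] vanishes. *)
have Nx : x \in N.
  have sZN : <[z]> \subset N by rewrite cycle_subG.
  exact: subsetP sZN x (central_expp p_pr pG cycZ Zz oz Zx (W_expp Wx)).
by apply/eqP; rewrite -subr_eq0 Fx ?sWP // FN.
Qed.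

(** The forms [a g] of the coordinate [Lam] may fail to be represented. The obstruction has
    dimension at most one; products of additive functions remove it and vanish on [Phi], so [Lam x]
    is unchanged. *)
Lemma exists_datum x : x \in Phi -> x \notin N -> exists w F b,
  [/\ datum w F b, {in N, forall n, F n = 0%R} & F x <> 0%R].
Proof.
move=> Px N'x; have sGGP : [~: G, G] \subset Phi.
  by rewrite (Phi_joing pG) joing_subl.
have [Lam [a [aM LamM aN LamN Lamx]]] :=
  class2_coordinate p_pr p_odd nNG sNPhi (Phi_sub G) sGGP sPhiGN powN Px N'x.
have [aMr aMl] := aM; have NP := subsetP sNPhi.
have [|f1 f2 eqf nr1 r2|[f fM nrf]|all_rep] := search_additive (P := fun f => ~ rep f).
- by move=> f; case: (rep_dec f) => ?; [right | left].
- by apply: nr1; apply: represented_ext r2 => h _.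
- have ex_k g : exists k, g \in G -> rep (fun h => a g h - k * f h)%R.
    have [Gg | _] := boolP (g \in G); last by exists 0%R.
    have [k rk] := derivable_dichotomy (derivable_additive fM) (derivable_additive (aMr g Gg)) nrf.
    by exists k.
  have [k kP] := fin_all_exists ex_k.
  have kM : additive_on G k.
    by apply: (coef_additive nrf _ kP) => g g' Gg Gg' h Gh; apply: aMl.
  have [t rt] := derivable_dichotomy (derivable_additive fM) (derivable_additive kM) nrf.
  (* Subtracting [k f] takes [k(g) f + f(g) k] off the form. As only [k - t f] is represented,
     [(t / 2) f ^ 2] is added to restore [t f(g) f]. *)
  pose t2 := (2%:R^-1 * t)%R; have tE : t = (2%:R * t2)%R by rewrite mulVKf ?two_neq0.
  pose F h := (Lam h - k h * f h + t2 * (f h * f h))%R.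
  pose b g h := (a g h - k g * f h - f g * (k h - t * f h))%R.
  have fP y : y \in Phi -> f y = 0%R by apply: (additive_Phi p_pr pG fM).
  have kPhi y : y \in Phi -> k y = 0%R by apply: (additive_Phi p_pr pG kM).
  have [||||w dw] := @realize_datum F b.
  + split=> g Gg h h' Gh Gh'; rewrite /b /=.
      by rewrite (aMr g Gg h h') // fM // kM //; ring.
    by rewrite (aMl g Gg h h') // fM // kM //; ring.
  + by move=> g h Gg Gh; rewrite /F /b LamM // fM // kM // tE; ring.
  + move=> g Gg; apply: (represented_sub W_normal chiM (kP g Gg)).
    exact: (represented_scale W_normal chiM (f g) rt).
  + by move=> n Nn; rewrite /F LamN // fP ?NP // !mulr0; ring.
  exists w, F, b; split=> //.
    by move=> n Nn; rewrite /F LamN // fP ?NP // !mulr0; ring.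
  by rewrite /F fP // !mulr0 subr0 addr0.
have [||||w dw] := @realize_datum Lam a; rewrite //; last by exists w, Lam, a.
by move=> g Gg; case: (rep_dec (a g)) => // nr; case: (all_rep (a g) (aMr g Gg)).
Qed.

(** An element [y] outside [N] with all commutators in [<[z]>] serves as [x]. If there is none,
    realizers of additive functions lie in [N], so [C_G(N)] lies in [Phi]; then [w1] detecting [x0]
    and [w2] detecting [w1] provide [r] and [x]. *)
Lemma exists_datum_order_p x0 : x0 \in 'C('Z(N)) -> x0 \in G -> x0 \notin N ->
  exists r F b x, [/\ datum r F b, r ^+ p = 1, {in N, forall n, F n = 0%R},
    x \in Phi & F x <> 0%R /\ {in G, forall u, u \in 'C(N) -> [~ u, x] \in 'Z(G)}].
Proof.
move=> cx0 Gx0 N'x0; have PG := subsetP (Phi_sub G).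
have F1 F : {in N, forall n, F n = 0%R} -> F 1 = 0%R by apply; apply: group1.
have inv0 (F : gT -> 'F_p) F' : {in N, forall n, F n = 0%R} -> {in N, forall n, F' n = 0%R} ->
    forall j : nat, {in N, forall n, F n + j%:R * F' n = 0}%R.
  by move=> FN F'N j n Nn; rewrite FN // F'N // mulr0 addr0.
have datumV w F b v Fv bv j : datum w F b -> datum v Fv bv ->
    datum (w * v ^+ j) (fun h => F h + j%:R * Fv h)%R (fun g h => b g h + j%:R * bv g h)%R.
  by move=> dw dv; apply: datum_mul dw (datum_exp j dv).
have [/existsP[y /and3P[Gy N'y /forall_inP yz]] | noy] :=
  boolP [exists y, [&& y \in G, y \notin N & [forall g in G, [~ y, g] \in <[z]>]]].
  have [f fM yf] := central_comm_additive Gy yz.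
  have Py := additive_realizer_Phi fM Gy yf.
  have [w [F [b [dw FN Fy]]]] := exists_datum Py N'y.
  have Gw : w \in G by case: dw.
  have dy := datum_additive Gy fM yf.
  (* Otherwise [f] is represented, so [f w = 0] and [w] commutes with [y], against [F y <> 0]. *)
  have bady : ~ adjustable y.
    move=> gy; have rf := adjustable_represented (realizes_ZPhi Gy (additive_invariant fM) yf) yf gy.
    have := additive_datum0 dw fM rf => fw; case: Fy; apply/eqP.
    rewrite -(datum_comm dw (F1 F FN) Py) -invg_comm invg_eq1.
    by rewrite (additive_comm fM yf Gw) fw.
  have [j rp] := datum_order_p_mul dw dy (or_intror Py) bady.
  have fN : {in N, forall n, f n = 0%R}.
    by move=> n Nn; rewrite (additive_Phi p_pr pG fM) // (subsetP sNPhi).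
  exists (w * y ^+ j), (fun h => F h + j%:R * f h)%R,
    (fun g h => b g h + j%:R * 0)%R, y; split=> //; first exact: datumV.
    exact: inv0.
  split=> [|u Gu _]; last by rewrite -invg_comm groupV (additive_central fM).
  by rewrite (additive_Phi p_pr pG fM) // mulr0 addr0.
have inN y f : y \in G -> additive_on G f -> realizes y f -> y \in N.
  move=> Gy fM yf; apply: contraNT noy => N'y; apply/existsP; exists y.
  rewrite Gy N'y /=; apply/forall_inP=> g Gg.
  exact: additive_comm_cycle fM yf Gg.
have cNPhi u : u \in G -> u \in 'C(N) -> u \in Phi.
  move=> Gu cu; apply: contraT => Phi'u.
  have [f fM fu] := separate_Phi p_pr pG Gu Phi'u.
  have [y Gy yf] := realize_additive fM; case: fu; apply/eqP.
  by rewrite -(additive_comm fM yf Gu); apply/commgP/esym/(centP cu)/(inN y f).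
have Px0 : x0 \in Phi.
  apply: contraT => Phi'x0.
  have [f fM fx0] := separate_Phi p_pr pG Gx0 Phi'x0.
  have [y Gy yf] := realize_additive fM; case: fx0; apply/eqP.
  rewrite -(additive_comm fM yf Gx0); apply/commgP/esym/(centP cx0).
  apply/centerP; split=> [|n Nn]; first exact: inN yf.
  have /centerP[_ cy] := realizes_ZPhi Gy (additive_invariant fM) yf.
  by apply: cy; apply: (subsetP sNPhi).
have dcN w F b : datum w F b -> {in N, forall n, F n = 0%R} -> w \in 'C(N).
  move=> dw FN; apply/centP=> n Nn; apply/commgP.
  by rewrite (datum_comm dw (F1 F FN)) ?FN // (subsetP sNPhi).
have dG w F b : datum w F b -> w \in G by case.
have dPhi w F b : datum w F b -> {in N, forall n, F n = 0%R} -> w \in Phi.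
  by move=> dw FN; apply: cNPhi; [apply: dG dw | apply: dcN dw FN].
have cZ w F b : datum w F b -> {in G, forall u, u \in 'C(N) -> [~ u, w] \in 'Z(G)}.
  by move=> dw u Gu cu; rewrite -invg_comm groupV (datum_central dw) // cNPhi.
have [w1 [Fa [b1 [d1 F1N F1x]]]] := exists_datum Px0 N'x0.
have P1 := dPhi _ _ _ d1 F1N.
(* Inside [N], the element [w1] would lie in ['Z(N)] and commute with [x0]. *)
have N'w1 : w1 \notin N.
  apply: contra_notN F1x => Nw1; apply/eqP; rewrite -(datum_comm d1 (F1 _ F1N) Px0).
  apply/commgP/esym/(centP cx0)/centerP; split=> // n Nn.
  exact: (centP (dcN _ _ _ d1 F1N)).
have [w2 [Fb [b2 [d2 F2N F2w]]]] := exists_datum P1 N'w1.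
have P2 := dPhi _ _ _ d2 F2N.
have F1w2 : Fa w2 <> 0%R.
  move/eqP; rewrite -(datum_comm d1 (F1 _ F1N) P2) -invg_comm invg_eq1.
  by rewrite (datum_comm d2 (F1 _ F2N) P1) => /eqP.
case: (adjustable_dec w2) => [g2 | bad2].
  have [r [dr rp _]] := datum_adjustable d2 g2.
  by exists r, Fb, b2, w1; split=> //; split=> //; apply: cZ d1.
(* Now [w2] serves as [x]: it commutes with itself, so [Fb w2 = 0] and the combined function takes
   the value [Fa w2] there. *)
have [j rp] := datum_order_p_mul d1 d2 (or_introl P1) bad2.
exists (w1 * w2 ^+ j), (fun h => Fa h + j%:R * Fb h)%R,
  (fun g h => b1 g h + j%:R * b2 g h)%R, w2; split=> //; first exact: datumV.
  exact: inv0.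
split; last exact: cZ d2.
have /eqP -> : Fb w2 == 0%R by rewrite -(datum_comm d2 (F1 _ F2N) P2) commgg.
by rewrite mulr0 addr0.
Qed.

(** * Contradiction from a datum with [r ^+ p = 1] *)

Section FinalDatum.

Variables (r x : gT) (F : gT -> 'F_p) (b : gT -> gT -> 'F_p).
Hypotheses (dr : datum r F b) (rp : r ^+ p = 1) (FN : {in N, forall n, F n = 0%R}).
Hypotheses (Px : x \in Phi) (Fx : F x <> 0%R).
Hypothesis cNx : {in G, forall u, u \in 'C(N) -> [~ u, x] \in 'Z(G)}.

Let Gr : r \in G. Proof. by case: dr. Qed.
Let rF : realizes r F. Proof. by case: dr. Qed.
Let bMr : {in G, forall g, additive_on G (b g)}. Proof. by case: dr => _ _ []. Qed.
Let bMl : {in G, forall h, additive_on G (b^~ h)}. Proof. by case: dr => _ _ []. Qed.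
Let FM : {in G &, forall g h, F (g * h)%g = (F g + F h + b g h)%R}. Proof. by case: dr. Qed.
Let rb : {in G, forall g, rep (b g)}. Proof. by case: dr. Qed.
Let F1 : F 1 = 0%R. Proof. by rewrite FN. Qed.

Let Frh h : h \in G -> F (r * h) = F h.
Proof. by move=> Gh; apply: comm_realizes rF Gr Gh (commgg r). Qed.

Let Fr : F r = 0%R. Proof. by rewrite -[r]mulg1 Frh. Qed.

Let bgr g : g \in G -> b g r = 0%R.
Proof. by move=> Gg; apply: additive_datum0 dr (bMr Gg) (rb Gg). Qed.

Let brh h : h \in G -> b r h = 0%R.
Proof.
by move=> Gh; apply: (addrI (F h)); rewrite addr0 -[RHS]Frh // FM // Fr add0r.
Qed.

Let rD := represented_add W_normal chiM.
Let rB := represented_sub W_normal chiM.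
Let rS := represented_scale W_normal chiM.

Let additive_r f h : additive_on G f -> f r = 0%R -> h \in G -> f (r * h) = f h.
Proof. by move=> fM fr Gh; rewrite fM // fr add0r. Qed.

(** For symmetric [b], the function [2 F(h) - b(h, h)] is additive, so it vanishes at [x], where its
    value is [2 F(x)]. *)
Lemma bilinear_asym : ~ {in G &, forall g h, b g h = b h g}.
Proof.
move=> bS; have fM : additive_on G (fun h => 2%:R * F h - b h h)%R.
  move=> g h Gg Gh /=; have Ggh := groupM Gg Gh.
  by rewrite FM // (bMr Ggh) // !(bMl _ Gg Gh) // (bS h g) //; ring.
have Gx := subsetP (Phi_sub G) x Px.
have := additive_Phi p_pr pG fM Px; have [-> _] := biadditive_Phi (conj bMr bMl) Px Gx.
by move/eqP; rewrite subr0 mulf_eq0 (negPf two_neq0) => /eqP.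
Qed.

(* [eps F + C] is realized over [<r> C_W(r)] by some [u] in [C_G(N)], and [[u, x]] would
   correspond to the nonconstant function [eps (F x)]. *)
Lemma no_product (eps C : gT -> 'F_p) h0 :
    additive_on G eps -> rep eps -> h0 \in G -> eps h0 <> 0%R ->
    Phi_invariant C -> {in G, forall h, C (r * h)%g = C h} ->
    {in G, forall g, rep (fun h => eps h * b g h + (C (g * h)%g - C h))%R} -> False.
Proof.
move=> eM reps Gh0 eh0 Cinv Cr repC.
have er : eps r = 0%R := additive_datum0 dr eM reps.
have eP := additive_invariant eM.
pose F2 h := (eps h * F h + C h)%R.
have rcomm g : g \in G -> commute r [~ r, g].
  move=> Gg; have [Wrg rg] := rF Gg; apply/esym.
  suff /setIP[_ /cent1P] : [~ r, g] \in 'C_W[r] by [].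
  by apply: rep_invariant_commute => // h Gh; rewrite !rg ?groupM // (datum_shift dr dr).
have F2Phi y h : y \in Phi -> h \in G -> F2 (y * h) = (F2 h + F y * eps h)%R.
  by move=> Py Gh; rewrite /F2 eP // (datum_Phi dr) // Cinv //; ring.
have [|h Gh|y /setIP[Wy /cent1P cyr] h Gh|u Gu [u1 uZ]] := realize_ext (F2 := F2) Gr rp rF rcomm.
(* Expanding the product leaves [eps g * F] plus a represented, [r]-invariant remainder. *)
- move=> g Gg; exists (eps g).
  exists (fun h => eps g * b g h + F g * eps h + (eps h * b g h + (C (g * h)%g - C h))
    + eps g * F g)%R; split=> [|h Gh|h Gh].
  + apply: (rD _ (rep_const _)); apply: (rD _ (repC g Gg)).
    exact: (rD (rS (eps g) (rb Gg)) (rS (F g) reps)).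
  + rewrite (bMr Gg) // bgr // add0r (additive_r eM) // Cr //.
    suff -> : C (g * (r * h)) = C (g * h) by [].
    have [Wrg _] := rF Gg; have Grg := subsetP W_G _ Wrg.
    have Pgr : [~ g, r] \in Phi by rewrite -invg_comm groupV (subsetP W_Phi).
    have -> : g * (r * h) = r * (g * ([~ g, r] * h)).
      by rewrite (mulgA g) (commgC g r) -(mulgA (r * g)) -(mulgA r).
    have Grh : g * ([~ g, r] * h) \in G by apply: groupM Gg (groupM (groupR Gg Gr) Gh).
    by rewrite (Cr _ Grh) (Phi_invariantP Cinv Gg Pgr Gh).
  by rewrite /F2 eM // FM //; ring.
- by rewrite /F2 (additive_r eM) // Frh // Cr.
- have Py := subsetP W_Phi y Wy.
  suff Fy : F y = 0%R by rewrite F2Phi // Fy mul0r addr0.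
  by apply/eqP; rewrite -(datum_comm dr F1 Py); apply/commgP/esym.
have cuN : u \in 'C(N).
  apply/centP=> n Nn; apply/commgP/eqP; have Pn := subsetP sNPhi n Nn.
  apply: u1 => [|h Gh]; first exact: subsetP (Phi_sub G) n Pn.
  by rewrite F2Phi // FN // mul0r addr0.
have Gx := subsetP (Phi_sub G) x Px.
have := uZ x h0 Gx Gh0 (cNx Gu cuN); rewrite F2Phi // -[in RHS](mulg1 x) F2Phi //.
rewrite (additive1 eM) mulr0 addr0 subrr addrC addKr => /eqP.
by rewrite mulf_eq0 => /orP[] /eqP.
Qed.

Lemma nonzero_on f : (exists2 h, h \in G & f h <> 0%R) \/ {in G, forall h, f h = 0%R}.
Proof.
have [/existsP[h /andP[Gh /eqP fh]] | nof] := boolP [exists h, (h \in G) && (f h != 0%R)].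
  by left; exists h.
right=> h Gh; apply/eqP; apply: contraNT nof => fh.
by apply/existsP; exists h; rewrite Gh.
Qed.

Lemma bilinear_nonzero : exists g h, [/\ g \in G, h \in G & b g h <> 0%R].
Proof.
have [/existsP[g /existsP[h /and3P[Gg Gh /eqP bgh]]] | nob] :=
  boolP [exists g, exists h, [&& g \in G, h \in G & b g h != 0%R]]; first by exists g, h.
have b0 g h : g \in G -> h \in G -> b g h = 0%R.
  move=> Gg Gh; apply/eqP; apply: contraNT nob => bgh.
  by apply/existsP; exists g; apply/existsP; exists h; rewrite Gg Gh.
by case: bilinear_asym => g h Gg Gh; rewrite !b0.
Qed.

(** Otherwise, modulo represented functions, [b g0 * b g] is [k g * f] with [k] additive, and [k] is
    [t f]. Then [C = (t / 2) f ^ 2 - k f] has difference [- k g * f], and [no_product] applies with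
    [eps = b g0]. *)
Lemma kernel_represented f : additive_on G f -> f r = 0%R -> rep f.
Proof.
move=> fM fr; case: (rep_dec f) => // nrf; exfalso.
have [g0 [h0 [Gg0 Gh0 bgh0]]] := bilinear_nonzero.
have dbb g : g \in G -> derivable (fun h => b g0 h * b g h)%R.
  by move=> Gg; apply: derivable_mul (bMr Gg0) (bMr Gg) (rb Gg0) (rb Gg).
have ex_k g : exists k, g \in G -> rep (fun h => b g0 h * b g h - k * f h)%R.
  have [Gg | _] := boolP (g \in G); last by exists 0%R.
  by have [k rk] := derivable_dichotomy (derivable_additive fM) (dbb g Gg) nrf; exists k.
have [k kP] := fin_all_exists ex_k.
have kM : additive_on G k.
  apply: (coef_additive (T := fun g h => (b g0 h * b g h)%R) nrf _ kP).
  by move=> g g' Gg Gg' h Gh; rewrite (bMl Gh) // mulrDr.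
have kr : k r = 0%R.
  apply: (not_rep_unique nrf); apply: represented_ext (rS (-1)%R (kP r Gr)) => h Gh /=.
  by rewrite brh //; ring.
have [t rt] := derivable_dichotomy (derivable_additive fM) (derivable_additive kM) nrf.
pose t2 := (2%:R^-1 * t)%R; have tE : t = (2%:R * t2)%R by rewrite mulVKf ?two_neq0.
pose C h := (t2 * (f h * f h) - k h * f h)%R.
apply: (@no_product (b g0) C h0 (bMr Gg0) (rb Gg0) Gh0 bgh0) => [y h Py Gh|h Gh|g Gg].
- by rewrite /C (additive_invariant fM) // (additive_invariant kM).
- by rewrite /C !additive_r.
apply: represented_ext (rD (rB (kP g Gg) (rS (f g) rt))
  (rep_const (t2 * (f g * f g) - k g * f g)%R)) => h Gh /=.
by rewrite /C fM // kM // tE; ring.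
Qed.

Let two_halves (c : 'F_p) : (c = 2%:R^-1 * (2%:R * c))%R.
Proof. by rewrite mulKf ?two_neq0. Qed.

(** By polarization, represented squares would make every [b g0 * b g] represented, and [no_product]
    would apply with [C = 0]. *)
Lemma some_square_not_represented :
  ~ (forall f, additive_on G f -> f r = 0%R -> rep (fun h => f h * f h)%R).
Proof.
move=> sq; have [g0 [h0 [Gg0 Gh0 bgh0]]] := bilinear_nonzero.
apply: (@no_product (b g0) (fun=> 0%R) h0 (bMr Gg0) (rb Gg0) Gh0 bgh0) => // g Gg.
pose f h := (b g0 h + b g h)%R.
have fM : additive_on G f by move=> h k Gh Gk; rewrite /f (bMr Gg0) // (bMr Gg) //; ring.
have fr : f r = 0%R by rewrite /f !bgr // addr0.
apply: represented_ext (rS (2%:R^-1)%R (rB (rB (sq f fM fr) (sq (b g0) (bMr Gg0) (bgr Gg0)))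
  (sq (b g) (bMr Gg) (bgr Gg)))) => h Gh /=.
by rewrite subrr addr0 [RHS]two_halves /f; congr (_ * _)%R; ring.
Qed.

(** If there were only multiples of [f1], then [b g h] would be a multiple of [f1 g * f1 h], hence
    symmetric. *)
Lemma independent_additive f1 h1 : additive_on G f1 -> f1 r = 0%R -> h1 \in G ->
    f1 h1 <> 0%R ->
  exists f2, [/\ additive_on G f2, f2 r = 0%R
    & forall c, ~ {in G, forall h, f2 h = (c * f1 h)%R}].
Proof.
move=> f1M f1r Gh1 f1h1.
have dec_c f : (exists c, {in G, forall h, f h = (c * f1 h)%R})
  \/ (forall c, ~ {in G, forall h, f h = (c * f1 h)%R}).
  apply: fin_search => c; have [/forall_inP fc | nfc] := boolP [forall h in G, f h == c * f1 h]%R.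
    by left=> h Gh; apply/eqP/fc.
  by right=> fc; case/forall_inP: nfc => h Gh; apply/eqP/fc.
have [f|fa fb eqf [far fac]|[f2 f2M [f2r f2c]]|none] := search_additive
  (P := fun f => f r = 0%R /\ forall c, ~ {in G, forall h, f h = (c * f1 h)%R}).
- have [/eqP fr | /eqP nfr] := boolP (f r == 0%R); last by right=> -[].
  by case: (dec_c f) => [[c fc] | nfc]; [right=> -[_ /(_ c)] | left].
- split=> [|c fbc]; first by rewrite -eqf.
  by apply: (fac c) => h Gh; rewrite eqf fbc.
- by exists f2.
have mult f : additive_on G f -> f r = 0%R -> exists c, {in G, forall h, f h = (c * f1 h)%R}.
  by move=> fM fr; case: (dec_c f) => // nfc; case: (none f fM).
have [c bc] := mult _ (bMl Gh1) (brh Gh1).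
case: bilinear_asym.
have nz : (f1 h1 != 0)%R by apply/eqP.
have bE g h : g \in G -> h \in G -> b g h = (c / f1 h1 * f1 g * f1 h)%R.
  move=> Gg Gh; have [d bd] := mult _ (bMr Gg) (bgr Gg).
  have := bd h1 Gh1; rewrite bc // => cd.
  rewrite bd //; congr (_ * _)%R; apply: (mulIf nz); rewrite -cd.
  by rewrite mulrAC divfK.
by move=> g h Gg Gh; rewrite !bE //; ring.
Qed.

Lemma no_datum_order_p : False.
Proof.
have rep0 : rep (fun=> 0%R) := rep_const 0%R.
have [f||[f1 f1M [f1r nrep]]|none] := search_additive
  (P := fun f => f r = 0%R /\ ~ rep (fun h => f h * f h)%R).
- have [/eqP fr | /eqP nfr] := boolP (f r == 0%R); last by right=> -[].
  by case: (rep_dec (fun h => f h * f h)%R) => ?; [right=> -[] | left].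
- move=> fa fb eqf [far nra]; split=> [|rfb]; first by rewrite -eqf.
  by apply: nra; apply: represented_ext rfb => h _; rewrite eqf.
- pose P0 h := (f1 h * f1 h)%R.
  have rf1 := kernel_represented f1M f1r.
  have dP0 : derivable P0 := derivable_mul f1M f1M rf1 rf1.
  have [[h1 Gh1 f1h1] | f10] := nonzero_on f1; last first.
    by apply: nrep; apply: represented_ext rep0 => h Gh; rewrite f10 // mulr0.
  have [f2 [f2M f2r f2c]] := independent_additive f1M f1r Gh1 f1h1.
  have rf2 := kernel_represented f2M f2r.
  have [c12 rep12] := derivable_dichotomy dP0 (derivable_mul f1M f2M rf1 rf2) nrep.
  have ex_K (e : {ffun gT -> 'F_p}) : exists K : {ffun gT -> 'F_p},
      additive_on G e -> e r = 0%R ->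
    {in G, forall g, rep (fun h => e h * b g h - K g * P0 h)%R}.
    case: (additive_dec e) => [eM | neM]; last by exists [ffun=> 0%R].
    have [/eqP er | /eqP ner] := boolP (e r == 0%R); last by exists [ffun=> 0%R].
    have re := kernel_represented eM er.
    have ex_k g : exists k, g \in G -> rep (fun h => e h * b g h - k * P0 h)%R.
      have [Gg | _] := boolP (g \in G); last by exists 0%R.
      have [k rk] := derivable_dichotomy dP0 (derivable_mul eM (bMr Gg) re (rb Gg)) nrep.
      by exists k.
    have [k kP] := fin_all_exists ex_k; exists [ffun g => k g] => _ _ g Gg.
    by apply: represented_ext (kP g Gg) => h _; rewrite ffunE.
  (* The coefficient [K e g] of [f1 ^ 2] in [e (b g)] is the obstruction to [no_product] for
     [C = 0]. Either [K] kills some [e <> 0], or it is onto by finiteness and takes the value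
     cancelling the obstruction [- kap] of [C = f1 ^ 2 f2]. *)
  have [K KP] := fin_all_exists ex_K.
  have KM (e : {ffun gT -> 'F_p}) : additive_on G e -> e r = 0%R -> additive_on G (K e).
    move=> eM er; apply: (coef_additive (T := fun g h => (e h * b g h)%R) nrep _ (KP e eM er)).
    by move=> g g' Gg Gg' h Gh; rewrite (bMl Gh) // mulrDr.
  have Kr (e : {ffun gT -> 'F_p}) : additive_on G e -> e r = 0%R -> K e r = 0%R.
    move=> eM er; apply: (not_rep_unique nrep).
    apply: represented_ext (rS (-1)%R (KP e eM er r Gr)) => h Gh /=.
    by rewrite brh // /P0; ring.
  (* Vanishing outside [G] makes members of [S] equal once they agree on [G], so that counting in
     [S] is meaningful. *)
  pose cut (f : gT -> 'F_p) : {ffun gT -> 'F_p} := [ffun h => if h \in G then f h else 0%R].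
  have cutE f h : h \in G -> cut f h = f h by move=> Gh; rewrite ffunE Gh.
  pose S := [set e : {ffun gT -> 'F_p} | [&& [forall g in G, forall h in G, e (g * h)%g == (e g + e h)%R],
    e r == 0%R & cut e == e]].
  have SP (e : {ffun gT -> 'F_p}) : e \in S -> [/\ additive_on G e, e r = 0%R & cut e = e].
    rewrite inE => /and3P[/forall_inP eM /eqP er /eqP ce]; split=> // g h Gg Gh.
    by have /forall_inP/(_ h Gh)/eqP := eM g Gg.
  have cutS f : additive_on G f -> f r = 0%R -> cut f \in S.
    move=> fM fr; rewrite inE cutE // fr eqxx /=; apply/andP; split.
      apply/forall_inP=> g Gg; apply/forall_inP=> h Gh.
      by rewrite !cutE ?groupM // fM.
    by apply/eqP/ffunP=> h; rewrite !ffunE; case: ifP => // ->.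
  pose KS (e : {ffun gT -> 'F_p}) := cut (K e).
  have KSS (e : {ffun gT -> 'F_p}) : e \in S -> KS e \in S by case/SP=> eM er _; apply: cutS; [apply: KM | apply: Kr].
  (* Modulo represented functions, the difference of [f1 ^ 2 f2] at [g] is
     [(f2 g + 2 c12 f1 g) f1 ^ 2]. *)
  pose kap h := (- (f2 h + 2%:R * c12 * f1 h))%R.
  have kapM : additive_on G kap.
    by move=> g h Gg Gh; rewrite /kap f1M // f2M //; ring.
  have kapr : kap r = 0%R by rewrite /kap f1r f2r mulr0 addr0 oppr0.
  have [injK | /dinjectivePn[e1 Se1 [e2 /andP[ne21 Se2] eqK]]] := boolP (dinjectiveb KS S).
    have imK : KS @: S = S.
      apply/eqP; rewrite eqEcard card_in_imset ?leqnn ?andbT; last exact/dinjectiveP.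
      by apply/subsetP=> _ /imsetP[e Se ->]; apply: KSS.
    have: cut kap \in KS @: S by rewrite imK cutS.
    case/imsetP=> e Se kapE; have [eM er _] := SP e Se.
    have Ke g : g \in G -> K e g = kap g.
      by move=> Gg; rewrite -(cutE kap) // kapE cutE.
    have [[h0 Gh0 eh0] | e0] := nonzero_on e; last first.
      (* If [e] were zero, so would be [kap], and [f2] would be a multiple of [f1]. *)
      apply: (f2c (- (2%:R * c12))%R) => g Gg.
      suff : kap g = 0%R.
        by move/eqP; rewrite oppr_eq0 addr_eq0 mulNr => /eqP.
      rewrite -Ke //; apply: (not_rep_unique nrep).
      apply: represented_ext (rS (-1)%R (KP e eM er g Gg)) => h Gh /=.
      by rewrite e0 // /P0; ring.
    pose C h := (f1 h * f1 h * f2 h)%R.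
    apply: (@no_product e C h0 eM (kernel_represented eM er) Gh0 eh0) => [y h Py Gh|h Gh|g Gg].
    - by rewrite /C (additive_invariant f1M) // (additive_invariant f2M).
    - by rewrite /C !additive_r.
    apply: represented_ext (rD (KP e eM er g Gg) (rD (rS (2%:R * f1 g)%R rep12)
      (rD (rS (f1 g * f1 g)%R rf2) (rD (rS (2%:R * f1 g * f2 g)%R rf1)
       (rep_const (f1 g * f1 g * f2 g)%R))))) => h Gh /=.
    by rewrite Ke // /C /P0 /kap f1M // f2M //; ring.
  have [e1M e1r e1c] := SP _ Se1; have [e2M e2r e2c] := SP _ Se2.
  (* The equal coefficients cancel, so every [e * b g] is represented. *)
  pose e h := (e1 h - e2 h)%R.
  have eM : additive_on G e.
    by move=> g h Gg Gh; rewrite /e e1M // e2M //; ring.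
  have er : e r = 0%R by rewrite /e e1r e2r subr0.
  have [[h0 Gh0 eh0] | e0] := nonzero_on e; last first.
    case/eqP: ne21; rewrite -e2c -e1c; apply/ffunP=> h; rewrite !ffunE.
    by case: ifP => // Gh; apply/esym/eqP; rewrite -subr_eq0 -/(e h) e0.
  apply: (@no_product e (fun=> 0%R) h0 eM (kernel_represented eM er) Gh0 eh0) => // g Gg.
  apply: represented_ext (rB (KP e1 e1M e1r g Gg) (KP e2 e2M e2r g Gg)) => h Gh /=.
  have <- : K e1 g = K e2 g by rewrite -(cutE (K e1)) // -[cut _]/(KS e1) eqK cutE.
  by rewrite /e; ring.
apply: some_square_not_represented => f fM fr.
case: (rep_dec (fun h => f h * f h)%R) => // nrf.
by case: (none f fM).
Qed.

End FinalDatum.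

End Exponent.

End Core.

(** * The subgroup gamma_3(G) G^p *)

Theorem theorem5p2 (gT : finGroupType) (G : {group gT}) (p : nat) :
  prime p -> odd p -> p.-group G -> ~~ abelian G -> cyclic 'Z(G) ->
  ~~ ('C_G('Z([~: G, G, G] * pow_subgroup G p)) \subset [~: G, G, G] * pow_subgroup G p) ->
  exists2 a : {perm gT}, a \in Aut G & (#[a] = p /\ a \notin Inn G).
Proof.
move=> p_pr p_odd pG nabG cycZ.
have [/existsP[a /and3P[Aa /eqP oa nInn]] _ | no_a] :=
  boolP [exists a : {perm gT}, [&& a \in Aut G, #[a] == p & a \notin Inn G]]; first by exists a.
have autG_inner (a : {perm gT}) : a \in Aut G -> #[a] = p -> a \in Inn G.
  move=> Aa oa; apply: contraNT no_a => nInn.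
  by apply/existsP; exists a; rewrite Aa oa eqxx.
have ntG : G :!=: 1 by apply: contraNneq nabG => ->; apply: abelian1.
have defPow : pow_subgroup G p = 'Mho^1(G) by rewrite (MhoE 1 pG) expn1.
pose N := ([~: G, G, G] <*> 'Mho^1(G))%G.
have nLG : [~: G, G, G] <| G by apply: (lcn_normal 3 G).
have nMG : 'Mho^1(G) <| G := Mho_normal 1 G.
have -> : [~: G, G, G] * pow_subgroup G p = N.
  rewrite defPow /= norm_joinEr //.
  exact: subset_trans (normal_sub nMG) (normal_norm nLG).
case/subsetPn=> x0 /setIP[Gx0 cx0] N'x0.
have nNG : N <| G by apply: normalY.
have PhiE : 'Phi(G) = [~: G, G] * 'Mho^1(G).
  rewrite (Phi_joing pG) norm_joinEr //.
  exact: subset_trans (normal_sub nMG) (normal_norm (der_normal 1 G)).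
have sNPhi : N \subset 'Phi(G).
  rewrite (Phi_joing pG) /= join_subG joing_subr andbT.
  by apply: subset_trans (joing_subl _ _); rewrite commg_subl (normal_norm (der_normal 1 G)).
have powN : {in G, forall g, g ^+ p \in N}.
  move=> g Gg; rewrite mem_gen // inE; apply/orP; right.
  by rewrite -defPow mem_gen // (imset_f (fun x => x ^+ p)).
(* In ['Phi(G) = [~: G, G] * 'Mho^1(G)], the first factor has its commutators with [G] in
   gamma_3(G), and the second lies in the normal subgroup [N]. *)
have sPhiGN : [~: 'Phi(G), G] \subset N.
  rewrite gen_subG; apply/subsetP=> _ /imset2P[_ g /[!PhiE]/mulsgP[a c Ga Mc ->] Gg ->].
  have Nc : c \in N by rewrite mem_gen // inE Mc orbT.
  have Gc : c \in G := subsetP (normal_sub nNG) c Nc.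
  have NJ y h : y \in N -> h \in G -> y ^ h \in N.
    by move=> Ny Gh; rewrite memJ_norm // (subsetP (normal_norm nNG)).
  rewrite commMgJ groupM ?NJ //.
    by rewrite mem_gen // inE mem_commg.
  by rewrite commgEl groupM ?groupV ?NJ.
have pZ : p.-group 'Z(G) := pgroupS (center_sub G) pG.
have ntZ : 'Z(G) != 1 by rewrite (center_nil_eq1 (pgroup_nil pG)).
have [_ p_dv_Z _] := pgroup_pdiv pZ ntZ.
have [z Zz oz] := Cauchy p_pr p_dv_Z.
have zK := central_socle_normal p_pr pG cycZ Zz oz.
have Phiz : z \in 'Phi(G).
  apply: zK (Phi_normal G) _.
  by rewrite (trivg_Phi pG); apply: contra nabG => /abelem_abelian.
have ntz : z != 1 by rewrite -order_gt1 oz prime_gt1.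
have [chi chiM chiz] := separate_abelem p_pr (W_abelem pG) (W_z p_pr pG cycZ Zz oz Phiz) ntz.
(* If [N] were trivial, all commutators would be powers of [z], so every [y] would realize an
   additive function and lie in the proper subgroup ['Phi(G)]. *)
have Nz : z \in N.
  apply: zK => //; apply/eqP=> N1.
  suff sGPhi : G \subset 'Phi(G) by have := Phi_proper ntG; rewrite properE sGPhi andbF.
  apply/subsetP=> y Gy.
  have yz : {in G, forall g, [~ y, g] \in <[z]>}.
    move=> g Gg; apply: (central_expp p_pr pG cycZ Zz oz); last first.
      by apply/set1gP; rewrite -N1 powN ?groupR.
    apply/centerP; split=> [|h Gh]; first exact: groupR.
    apply/commgP/eqP/set1gP; rewrite -N1 (subsetP (joing_subl _ _)) //.
    by rewrite !mem_commg.
  have [f fM yf] := central_comm_additive p_pr pG cycZ Zz oz Phiz chiM Gy yz.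
  exact: (additive_realizer_Phi p_pr p_odd pG cycZ Zz oz autG_inner Phiz chiM chiz fM Gy yf).
have [r [F [b [x [dr rp FN Px [Fx cNx]]]]]] :=
  exists_datum_order_p p_pr p_odd pG cycZ Zz oz autG_inner Phiz chiM chiz nNG sNPhi sPhiGN
    powN Nz cx0 Gx0 N'x0.
case: (no_datum_order_p p_pr p_odd pG cycZ Zz oz autG_inner Phiz chiM chiz sNPhi dr rp FN Px Fx cNx).
Qed.
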